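(* For each $n\ge 1$ let $A=(A_{ij})_{i,j=1}^n$ be a random matrix whose entries are independent and uniformly distributed on $\{+1,-1\}$, and let $\Delta_q=\Delta_q(A)$ be the entangled value of the 2-player XOR game with matrix $A$ and uniformly distributed questions. Then $$\Delta_q=\frac{2\pm o(1)}{\sqrt n}\quad\text{with probability } 1-o(1)\qquad (n\to\infty),$$ that is, for every $\epsilon>0$, $\Pr\left[\,\left|\sqrt n\,\Delta_q-2\right|\le\epsilon\,\right]\to 1$ as $n\to\infty$.
   Context: In the 2-player XOR game given by a matrix $A\in\{\pm1\}^{n\times n}$ with uniform questions, a referee picks $(i,j)\in\{1,\dots,n\}^2$ uniformly at random and sends $i$ to the first player and $j$ to the second; the players, who cannot communicate, answer with bits $x,y\in\{0,1\}$. They win if $x=y$ when $A_{ij}=1$, respectively $x\ne y$ when $A_{ij}=-1$. The entangled value $\Delta_q$ is the maximum, over strategies using a shared entangled quantum state, of the winning probability minus the losing probability. By Tsirelson's theorem it equals (and may be taken as defined by) $$\Delta_q(A)=\max_{u_1,\dots,u_n,\,v_1,\dots,v_n}\ \frac1{n^2}\sum_{i,j=1}^n A_{ij}\,(u_i,v_j),$$ where the maximum is over all tuples of unit vectors $u_i,v_j\in\mathbb R^d$ in an arbitrary number of dimensions $d$, and $(\cdot,\cdot)$ is the Euclidean inner product. *)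

(* Defs.v *)
From HB Require Import structures.
From mathcomp Require Export all_boot all_order all_algebra.
From mathcomp Require Export all_classical all_reals all_analysis.
Export Order.TTheory GRing.Theory Num.Theory.
Export numFieldNormedType.Exports.

Set Implicit Arguments.
Unset Strict Implicit.
Unset Printing Implicit Defensive.

Local Open Scope classical_set_scope.
Local Open Scope ring_scope.

Section EntangledValue.
Variable R : realType.

Definition inner d (u v : 'rV[R]_d) : R := \sum_(k < d) u 0 k * v 0 k.

(* Stated with [inner]: the library norm `|u| on 'rV[R]_d is the sup norm. *)
Definition unit_vector d (u : 'rV[R]_d) : Prop := inner u u = 1.

Definition xor_correlation n d (A : 'M[R]_n)
    (u v : 'I_n -> 'rV[R]_d) : R :=
  (n%:R ^+ 2)^-1 * \sum_(i < n) \sum_(j < n) A i j * inner (u i) (v j).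

Definition xor_correlations n (A : 'M[R]_n) : set R :=
  [set r | exists d (u v : 'I_n -> 'rV[R]_d),
     [/\ forall i, unit_vector (u i), forall j, unit_vector (v j)
       & r = xor_correlation A u v]].

(* Tsirelson's vector form, for uniform questions. The maximum over all
   dimensions is written as a supremum; [has_sup_xor_correlations] shows that
   [sup] does not take its default value. *)
Definition entangled_value n (A : 'M[R]_n) : R := sup (xor_correlations A).

Lemma normr_inner_le1 d (u v : 'rV[R]_d) :
  unit_vector u -> unit_vector v -> `|inner u v| <= 1.
Proof.
move=> hu hv.
have sq w : (forall k, 0 <= w k) -> 0 <= \sum_(k < d) w k :> R.
  by move=> hw; apply: sumr_ge0.
have hB : 0 <= inner u u + inner v v - (inner u v) *+ 2.
  rewrite /inner -sumrMnl -big_split -sumrB /=; apply: sq => k.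
  by rewrite -!expr2 addrAC -sqrrB sqr_ge0.
have hD : 0 <= inner u u + inner v v + (inner u v) *+ 2.
  rewrite /inner -sumrMnl -!big_split /=; apply: sq => k.
  by rewrite -!expr2 addrAC -sqrrD sqr_ge0.
move: hB hD; rewrite hu hv -mulr2n -mulrnBl -mulrnDl !pmulrn_lge0 // => hB hD.
by rewrite ler_norml -subr_ge0 opprK addrC hD -subr_ge0 hB.
Qed.

Lemma has_sup_xor_correlations n (A : 'M[R]_n) : has_sup (xor_correlations A).
Proof.
have u1 : unit_vector (const_mx 1 : 'rV[R]_1).
  by rewrite /unit_vector /inner big_ord1 mxE mulr1.
split.
  by eexists; exists 1%N, (fun=> const_mx 1), (fun=> const_mx 1); split.
exists ((n%:R ^+ 2)^-1 * \sum_(i < n) \sum_(j < n) `|A i j|).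
move=> _ [d [u [v [hu hv ->]]]].
apply: ler_wpM2l; first by rewrite invr_ge0 exprn_ge0.
apply: ler_sum => i _; apply: ler_sum => j _.
apply: le_trans (ler_norm _) _; rewrite normrM.
by apply: ler_piMr => //; exact: normr_inner_le1.
Qed.

End EntangledValue.

Section RandomSigns.
Context d (T : measurableType d) (R : realType) (P : probability T R).

(* The product rule for every finite subfamily J. *)
Definition mutually_independent (I : finType) (X : I -> {RV P >-> R}) : Prop :=
  forall (J : {set I}) (B : I -> set R), (forall i, measurable (B i)) ->
    P (\bigcap_(i in [set` J]) (X i @^-1` B i)) =
      (\prod_(i in J) P (X i @^-1` B i))%E.

Definition uniform_sign (X : {RV P >-> R}) : Prop :=
  [/\ forall w, X w = 1 \/ X w = -1,
      P (X @^-1` [set 1]) = (2^-1)%:E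
    & P (X @^-1` [set -1]) = (2^-1)%:E].

Definition random_sign_matrix n (A : 'I_n -> 'I_n -> {RV P >-> R}) : Prop :=
  (forall i j, uniform_sign (A i j)) /\
  mutually_independent (fun ij : 'I_n * 'I_n => A ij.1 ij.2).

End RandomSigns.

(* Main.v *)
Require Import Defs.
From mathcomp Require Import ring lra zify.

(* Write M = A A^T and C_k for the Catalan numbers; M^k has diagonal entries close
   to C_k n^k and trace close to C_k n^(k+1).

   Upper bound on moments: for a polynomial F in the entries with nonnegative
   coefficients, E[x_e F] <= E[dF/dx_e], since cancelling x_e against another
   occurrence of the same entry keeps a monomial's expectation, which is 0 or 1.
   Applied to one entry of a product of traces and diagonal entries of powers of M,
   this gives Catalan's recursion up to a relative error poly(k)/n, valid for k up
   to a small power of n.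

   Lower bound on moments: decompose closed walks at their first return and keep
   only the returns along the edge of departure, whose sign squares to 1.

   The trace bound at k ~ n^(1/10) yields |A| <= (2 + o(1)) sqrt n, and the value is
   at most |A| / n. Conversely, for fixed k, let u_i be the rows of M^k and v_j the
   rows of A^T M^k. By the second moment method their lengths are almost constant,
   so after normalization (with truncation of the few long ones) they give the value
   sqrt (C_(2k+1) / C_(2k)) / sqrt n, and this ratio tends to 2. *)

Set Implicit Arguments.
Unset Strict Implicit.
Unset Printing Implicit Defensive.

Local Open Scope ring_scope.

(** * Integration by parts for random signs *)

Section RademacherPolynomials.
Variables (R : realType) (n : nat).

Let edge := ('I_n * 'I_n)%type.

Definition signs := {ffun 'I_n * 'I_n -> bool}.
Definition sgn (s : signs) (e : edge) : R := (-1) ^+ s e.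
Definition mean (f : signs -> R) : R := #|signs|%:R^-1 * \sum_s f s.

Lemma sgn_sqr s e : sgn s e * sgn s e = 1.
Proof. by rewrite -expr2 sqrr_sign. Qed.

Lemma card_signs_gt0 : 0 < #|signs|%:R :> R.
Proof. by rewrite ltr0n; apply/card_gt0P; exists [ffun=> true]. Qed.

Lemma eq_mean f g : f =1 g -> mean f = mean g.
Proof. by move=> fg; rewrite /mean (eq_bigr g). Qed.

Lemma meanD f g : mean (fun s => f s + g s) = mean f + mean g.
Proof. by rewrite /mean big_split mulrDr. Qed.

Lemma meanZ c f : mean (fun s => c * f s) = c * mean f.
Proof. by rewrite /mean -mulr_sumr mulrCA. Qed.

Lemma mean_sum (I : Type) (r : seq I) (Q : pred I) (F : I -> signs -> R) :
  mean (fun s => \sum_(i <- r | Q i) F i s) = \sum_(i <- r | Q i) mean (F i).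
Proof. by rewrite /mean exchange_big mulr_sumr. Qed.

Lemma mean_cst c : mean (fun=> c) = c.
Proof.
by rewrite /mean sumr_const -[c *+ _]mulr_natl mulrA mulVf ?mul1r // lt0r_neq0 // card_signs_gt0.
Qed.

Lemma ler_mean f g : (forall s, f s <= g s) -> mean f <= mean g.
Proof.
move=> fg; apply: ler_wpM2l; first by rewrite invr_ge0 ler0n.
by apply: ler_sum => s _.
Qed.

Definition mon (w : seq edge) (s : signs) : R := \prod_(e <- w) sgn s e.

(** Leibniz rule on words: each occurrence of [e] is deleted in turn. Words are not reduced by x_e^2
    = 1 beforehand. *)
Fixpoint dmon (e : edge) (w : seq edge) (s : signs) : R :=
  if w is x :: w' then (x == e)%:R * mon w' s + sgn s x * dmon e w' s else 0.

Lemma mon_cons e w s : mon (e :: w) s = sgn s e * mon w s.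
Proof. by rewrite /mon big_cons. Qed.

Lemma mon_cat w1 w2 s : mon (w1 ++ w2) s = mon w1 s * mon w2 s.
Proof. by rewrite /mon big_cat. Qed.

Lemma dmon_cat e w1 w2 s :
  dmon e (w1 ++ w2) s = dmon e w1 s * mon w2 s + mon w1 s * dmon e w2 s.
Proof.
elim: w1 => [|x w1 IH] /=; first by rewrite /mon big_nil; ring.
by rewrite IH mon_cat mon_cons; ring.
Qed.

Definition flip (e : edge) (s : signs) : signs := [ffun x => s x (+) (x == e)].

Lemma flipK e : involutive (flip e).
Proof. by move=> s; apply/ffunP => x; rewrite !ffunE -addbA addbb addbF. Qed.

Lemma sgn_flip e s x : sgn (flip e s) x = if x == e then - sgn s x else sgn s x.
Proof.
by rewrite /sgn ffunE signr_addb; case: eqP => _; rewrite ?expr1 ?expr0 ?mulrN1 ?mulr1.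
Qed.

Lemma mean_flip e f : mean (f \o flip e) = mean f.
Proof. by rewrite /mean [in RHS](reindex_inj (can_inj (flipK e))). Qed.

(** Flipping the sign of [e] is a bijection of the sample space that negates this monomial. *)
Lemma mean_mon_notin e w : e \notin w -> mean (mon (e :: w)) = 0.
Proof.
move=> ew; have : mean (mon (e :: w)) = - mean (mon (e :: w)).
  rewrite -{1}(mean_flip e) -mulN1r -meanZ; apply: eq_mean => s /=.
  rewrite !mon_cons sgn_flip eqxx mulN1r mulNr; congr (- (_ * _)).
  rewrite /mon big_seq_cond [in RHS]big_seq_cond; apply: eq_bigr => x /andP[xw _].
  by rewrite sgn_flip; case: eqP => // xe; rewrite -xe xw in ew.
by move=> h; lra.
Qed.

Lemma mon_rem e w s : e \in w -> mon (e :: w) s = mon (rem e w) s.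
Proof.
by move=> ew; rewrite mon_cons {1}/mon (big_rem e) //= mulrA sgn_sqr mul1r.
Qed.

(** The first letter either recurs, and the pair cancels, or it does not, and the mean vanishes. The
    empty word has mean 1. *)
Lemma mean_mon_ge0 w : 0 <= mean (mon w).
Proof.
have [m] := ubnP (size w); elim: m w => // m IH [|e w] /= sw.
  by rewrite (eq_mean (g := fun=> 1)) ?mean_cst // => s; rewrite /mon big_nil.
have [ew|ew] := boolP (e \in w); last by rewrite mean_mon_notin.
rewrite (eq_mean (fun s => mon_rem s ew)); apply: IH.
by rewrite size_rem //; apply: leq_ltn_trans (leq_pred _) _.
Qed.

(** Polynomials in the entries with coefficients in the natural numbers, multiplicity being
    repetition in [L]. They are closed under products and have nonnegative mean, so [pos] of a
    difference compares two means, even under a further [pos] weight. *)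
Definition pos (f : signs -> R) : Prop :=
  exists L, f =1 fun s => \sum_(w <- L) mon w s.

(* [g] is the formal derivative in the entry [e] of a polynomial that restricts to
   [f]; it depends on that polynomial, since x_e^2 = 1 on signs. *)
Definition deriv e (f g : signs -> R) : Prop :=
  exists2 L, f =1 (fun s => \sum_(w <- L) mon w s)
           & g =1 (fun s => \sum_(w <- L) dmon e w s).

Lemma eq_pos f g : f =1 g -> pos f -> pos g.
Proof. by move=> fg [L hL]; exists L => s; rewrite -fg. Qed.

Lemma pos0 : pos (fun=> 0).
Proof. by exists [::] => s; rewrite big_nil. Qed.

Lemma posD f g : pos f -> pos g -> pos (fun s => f s + g s).
Proof. by move=> [L hL] [L' hL']; exists (L ++ L') => s; rewrite big_cat hL hL'. Qed.

Lemma pos1 : pos (fun=> 1).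
Proof. by exists [:: [::]] => s; rewrite big_seq1 /mon big_nil. Qed.

Lemma posM f g : pos f -> pos g -> pos (fun s => f s * g s).
Proof.
move=> [L hL] [L' hL']; exists [seq w ++ w' | w <- L, w' <- L'] => s.
rewrite hL hL' big_allpairs_dep mulr_suml; apply: eq_bigr => w _.
by rewrite mulr_sumr; apply: eq_bigr => w' _; rewrite mon_cat.
Qed.

Lemma pos_mon w : pos (mon w).
Proof. by exists [:: w] => s; rewrite big_seq1. Qed.

Lemma pos_sgn e : pos (sgn^~ e).
Proof. by apply: (eq_pos (f := mon [:: e])) (pos_mon _) => s; rewrite /mon big_seq1. Qed.

Lemma pos_sum (I : Type) (r : seq I) (Q : pred I) (F : I -> signs -> R) :
  (forall i, Q i -> pos (F i)) -> pos (fun s => \sum_(i <- r | Q i) F i s).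
Proof.
move=> hF; elim: r => [|i r IH].
  by apply: eq_pos pos0 => s; rewrite big_nil.
have [Qi|Qi] := boolP (Q i).
  by apply: eq_pos (posD (hF i Qi) IH) => s; rewrite big_cons Qi.
by apply: eq_pos IH => s; rewrite big_cons (negPf Qi).
Qed.

Lemma pos_nat m : pos (fun=> m%:R).
Proof.
by elim: m => [|m IH]; [exact: pos0 | apply: eq_pos (posD pos1 IH) => s; rewrite -natr1 addrC].
Qed.

Lemma pos_bool (b : bool) : pos (fun=> b%:R).
Proof. exact: pos_nat. Qed.

Lemma pos_prod (I : Type) (r : seq I) (F : I -> signs -> R) :
  (forall i, pos (F i)) -> pos (fun s => \prod_(i <- r) F i s).
Proof.
move=> hF; elim: r => [|i r IH]; first by apply: eq_pos pos1 => s; rewrite big_nil.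
by apply: eq_pos (posM (hF i) IH) => s; rewrite big_cons.
Qed.

Lemma pos_dmon e w : pos (dmon e w).
Proof.
elim: w => [|x w IH] /=; first exact: pos0.
exact: posD (posM (pos_bool _) (pos_mon _)) (posM (pos_sgn _) IH).
Qed.

Lemma mean_pos f : pos f -> 0 <= mean f.
Proof.
by move=> [L hL]; rewrite (eq_mean hL) mean_sum sumr_ge0 // => w _; exact: mean_mon_ge0.
Qed.

Lemma eq_deriv e f f' g g' : f =1 f' -> g =1 g' -> deriv e f g -> deriv e f' g'.
Proof. by move=> ff gg [L hf hg]; exists L => s; rewrite -?ff -?gg. Qed.

Lemma deriv0 e : deriv e (fun=> 0) (fun=> 0).
Proof. by exists [::] => s; rewrite big_nil. Qed.

Lemma deriv1 e : deriv e (fun=> 1) (fun=> 0).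
Proof. by exists [:: [::]] => s; rewrite big_seq1 // /mon big_nil. Qed.

Lemma deriv_bool e (b : bool) : deriv e (fun=> b%:R) (fun=> 0).
Proof. by case: b; [exact: deriv1 | exact: deriv0]. Qed.

Lemma derivD e f f' g g' : deriv e f g -> deriv e f' g' ->
  deriv e (fun s => f s + f' s) (fun s => g s + g' s).
Proof.
move=> [L hf hg] [L' hf' hg'].
by exists (L ++ L') => s; rewrite big_cat ?hf ?hf' ?hg ?hg'.
Qed.

Lemma derivM e f f' g g' : deriv e f g -> deriv e f' g' ->
  deriv e (fun s => f s * f' s) (fun s => g s * f' s + f s * g' s).
Proof.
move=> [L hf hg] [L' hf' hg']; exists [seq w ++ w' | w <- L, w' <- L'] => s.
  rewrite hf hf' big_allpairs_dep mulr_suml; apply: eq_bigr => w _.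
  by rewrite mulr_sumr; apply: eq_bigr => w' _; rewrite mon_cat.
rewrite hf hf' hg hg' big_allpairs_dep !mulr_suml -big_split; apply: eq_bigr => w _ /=.
by rewrite !mulr_sumr -big_split; apply: eq_bigr => w' _; rewrite dmon_cat.
Qed.

Lemma deriv_sgn e x : deriv e (sgn^~ x) (fun=> (x == e)%:R).
Proof.
exists [:: [:: x]] => s; rewrite big_seq1 /mon /=; first by rewrite big_seq1.
by rewrite /mon big_nil; ring.
Qed.

Lemma deriv_sum e (I : Type) (r : seq I) (F G : I -> signs -> R) :
  (forall i, deriv e (F i) (G i)) ->
  deriv e (fun s => \sum_(i <- r) F i s) (fun s => \sum_(i <- r) G i s).
Proof.
move=> hF; elim: r => [|i r IH].
  by apply: eq_deriv (deriv0 e) => s; rewrite big_nil.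
by apply: eq_deriv (derivD (hF i) IH) => s; rewrite big_cons.
Qed.

(* In a word containing [e] an odd number of times, cancelling the extra [e]
   against its first occurrence leaves one of the words of the derivative. *)
Lemma mean_sgn_mon_le e u w : e \notin u ->
  mean (fun s => sgn s e * (mon u s * mon w s)) <=
  mean (fun s => mon u s * dmon e w s).
Proof.
elim: w u => [|x w IH] u eu /=.
  rewrite (eq_mean (g := mon (e :: u))); last first.
    by move=> s; rewrite mon_cons /mon big_nil mulr1.
  by rewrite mean_mon_notin // (eq_mean (g := fun=> 0)) ?mean_cst // => s; rewrite mulr0.
have [->|xe] := eqVneq x e.
  rewrite (eq_mean (g := fun s => mon u s * mon w s)); last first.
    by move=> s; rewrite mon_cons mulrCA; congr (_ * _); rewrite mulrA sgn_sqr mul1r.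
  rewrite -subr_ge0 -mulN1r -meanZ -meanD.
  apply: mean_pos; apply: eq_pos (posM (pos_mon u) (posM (pos_sgn e) (pos_dmon e w))).
  by move=> s /=; ring.
(* A letter other than [e] moves into the prefix [u], which stays free of [e]. *)
have := IH (x :: u); rewrite inE eq_sym negb_or xe eu => /(_ isT).
rewrite (eq_mean (g := fun s => sgn s e * (mon u s * mon (x :: w) s))); last first.
  by move=> s; rewrite !mon_cons; ring.
move/le_trans; apply; rewrite le_eqVlt; apply/orP; left; apply/eqP; apply: eq_mean => s.
by rewrite mon_cons mul0r add0r; ring.
Qed.

(* Integration by parts: an equality for Gaussian entries, an inequality here. *)
Lemma mean_ibp e f g : deriv e f g -> mean (fun s => sgn s e * f s) <= mean g.
Proof.
move=> [L hf hg]; rewrite (eq_mean hg) mean_sum.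
rewrite (eq_mean (g := fun s => \sum_(w <- L) sgn s e * mon w s)); last first.
  by move=> s; rewrite hf mulr_sumr.
rewrite mean_sum; apply: ler_sum => w _.
have := @mean_sgn_mon_le e [::] w isT.
rewrite (eq_mean (g := fun s => sgn s e * mon w s)); last first.
  by move=> s; rewrite /mon big_nil mul1r.
by move/le_trans; apply; apply: ler_mean => s; rewrite /mon big_nil mul1r.
Qed.

End RademacherPolynomials.

(** * Catalan numbers *)

Section Catalan.
Variable R : realType.

(** Defined by the ratio of consecutive terms, from which growth bounds follow by direct induction;
    the convolution recursion is derived below. *)
Fixpoint catalan (k : nat) : R :=
  if k is k'.+1 then (4 * k'%:R + 2) / (k'%:R + 2) * catalan k' else 1.

Lemma catalanS k : (k%:R + 2) * catalan k.+1 = (4 * k%:R + 2) * catalan k.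
Proof.
have : (k%:R + 2 : R) != 0 by rewrite gt_eqF // ltr_wpDl // ler0n.
by move=> /= h; field.
Qed.

Arguments catalan : simpl never.

Lemma catalan_gt0 k : 0 < catalan k.
Proof.
elim: k => [|k IH]; first exact: ltr01.
by rewrite /catalan -/catalan mulr_gt0 // divr_gt0 // ltr_wpDl // ?mulr_ge0 // ler0n.
Qed.

Lemma catalan_leS k : catalan k <= catalan k.+1.
Proof.
have k0 : 0 <= k%:R :> R by rewrite ler0n.
rewrite -(ler_pM2l (_ : 0 < k%:R + 2)); last by rewrite ltr_wpDl.
by rewrite catalanS ler_pM2r ?catalan_gt0 //; lra.
Qed.

Lemma catalan_le k : catalan k <= 4 ^+ k.
Proof.
elim: k => [|k IH]; first by rewrite expr0.
have k0 : 0 <= k%:R :> R by rewrite ler0n.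
rewrite -(ler_pM2l (_ : 0 < k%:R + 2)); last by rewrite ltr_wpDl.
rewrite catalanS exprS mulrA; apply: ler_pM => //.
  by rewrite ltW // catalan_gt0.
lra.
Qed.

(** The induction step reduces to 4(k+1)^2 <= (k+2)(4k+2). A polynomial loss against 4^k is harmless
    later, where it is divided by n. *)
Lemma catalan_ge k : 4 ^+ k <= k.+1%:R ^+ 2 * catalan k.
Proof.
elim: k => [|k IH]; first by rewrite expr0 expr1n mul1r.
have k0 : 0 <= k%:R :> R by rewrite ler0n.
rewrite -(ler_pM2l (_ : 0 < k%:R + 2)); last by rewrite ltr_wpDl.
rewrite mulrCA catalanS exprS.
have C0 := catalan_gt0 k.
apply: (le_trans (y := 4 * (k%:R + 2) * (k.+1%:R ^+ 2 * catalan k))).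
  by rewrite mulrCA mulrA ler_pM2l // mulr_gt0 // ltr_wpDl.
rewrite !mulrA ler_pM2r // -[k.+1%:R]natr1 -[k.+2%:R]natr1 -[k.+1%:R]natr1; nra.
Qed.

(** The symmetry i <-> k - i replaces i by its average k/2. *)
Lemma catalan_conv_affine (a b : R) k :
  2 * \sum_(i < k.+1) (a + b * i%:R) * (catalan i * catalan (k - i)) =
  (2 * a + b * k%:R) * \sum_(i < k.+1) catalan i * catalan (k - i).
Proof.
rewrite mulr_natl mulr2n [X in X + _](reindex_inj rev_ord_inj) -big_split mulr_sumr.
apply: eq_bigr => i _ /=.
have ik : (i <= k)%N by rewrite -ltnS.
by rewrite subSS subKn // natrB //; ring.
Qed.

(** Weight the convolution S of order k+1 by 1 + i. Symmetry evaluates it as (k+3)S/2. Term by term,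
    the ratio recursion turns (i+2)C_(i+1) into (4i+2)C_i, an affine weight on the convolution of
    order k, which the induction hypothesis evaluates. This gives (k+3)S = (4k+6)C_(k+1). *)
Lemma catalan_conv k :
  \sum_(i < k.+1) catalan i * catalan (k - i) = catalan k.+1.
Proof.
elim: k => [|k IH]; first by rewrite big_ord1 /catalan /= mulr0 add0r; field.
have k0 : 0 <= k%:R :> R by rewrite ler0n.
have := catalan_conv_affine 1 1 k.+1.
rewrite big_ord_recl subn0 mulr0 addr0 mul1r.
have -> : \sum_(i < k.+1) (1 + 1 * (bump 0 i)%:R) *
     (catalan (bump 0 i) * catalan (k.+1 - bump 0 i)) =
   \sum_(i < k.+1) (2 + 4 * i%:R) * (catalan i * catalan (k - i)).
  apply: eq_bigr => i _; rewrite /bump leq0n add1n subSS mulrA [RHS]mulrA; congr (_ * _).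
  rewrite -[(i.+1)%:R]natr1 (_ : 1 + 1 * (i%:R + 1) = i%:R + 2); last by ring.
  by rewrite catalanS [2 + _]addrC.
rewrite mulrDr catalan_conv_affine IH => h.
have C0 : catalan 0 = 1 by [].
have h2 := catalanS k.+1; rewrite C0 -[k.+1%:R]natr1 in h h2.
set S := \sum_(i < k.+2) _ in h *.
have e : (k%:R + 3) * S = (k%:R + 3) * catalan k.+2 by lra.
by apply: mulfI e; rewrite gt_eqF // ltr_wpDl.
Qed.

(** Both sides are powers of 4 up to polynomial factors. *)
Lemma catalan_merge j k :
  catalan (j + k) <= ((j.+2%:R * k.+1%:R) ^+ 2) * (catalan j.+1 * catalan k).
Proof.
apply: le_trans (catalan_le _) _.
have h1 := catalan_ge j.+1; have h2 := catalan_ge k.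
apply: (le_trans (y := 4 ^+ j.+1 * 4 ^+ k)).
  by rewrite -exprD addSn exprS ler_peMl // ?exprn_ge0 //; lra.
apply: le_trans (ler_pM _ _ h1 h2) _; rewrite ?exprn_ge0 //.
by rewrite le_eqVlt; apply/orP; left; apply/eqP; ring.
Qed.

End Catalan.
Arguments catalan : simpl never.

(** * Moments of the Gram matrix *)

Section SquareMatrices.
Variables (R : comNzRingType) (n : nat).
Implicit Types A B Y Z : 'M[R]_n.

Lemma mulmx_entry A B i j : (A * B) i j = \sum_k A i k * B k j.
Proof. by rewrite -mulmxE mxE. Qed.

Lemma trmxM A B : (A * B)^T = B^T * A^T.
Proof. by rewrite -!mulmxE trmx_mul. Qed.

Lemma trmx_exp A k : (A ^+ k)^T = A^T ^+ k.
Proof. by elim: k => [|k IH]; rewrite ?expr0 ?trmx1 // exprS exprSr trmxM IH. Qed.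

Lemma mxtraceMC A B : \tr (A * B) = \tr (B * A).
Proof. by rewrite -!mulmxE mxtrace_mulC. Qed.

Lemma mul_delta_entry Y Z a b i j : (Y * delta_mx a b * Z) i j = Y i a * Z b j.
Proof.
rewrite mulmx_entry (bigD1 b) //= big1 ?addr0; last first.
  move=> k kb; rewrite mulmx_entry big1 ?mul0r // => l _.
  by rewrite mxE (negPf kb) andbF mulr0.
congr (_ * _); rewrite mulmx_entry (bigD1 a) //= big1 ?addr0; last first.
  by move=> l la; rewrite mxE (negPf la) mulr0.
by rewrite mxE !eqxx mulr1.
Qed.

Lemma mxtrace_delta_mul Z a b : \tr (delta_mx a b * Z) = Z b a.
Proof.
rewrite /mxtrace (bigD1 a) //= big1 ?addr0 => [|i ia].
  by rewrite -[delta_mx a b]mul1r mul_delta_entry mxE eqxx mul1r.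
by rewrite -[delta_mx a b]mul1r mul_delta_entry mxE (negPf ia) mul0r.
Qed.

(** An entry used twice in the same direction: the two remaining pieces join, one of them reversed,
    into a single closed walk. *)
Lemma sum_delta_trmx Y Z :
  \sum_a \sum_b (Y * delta_mx a b * Z) b a = \tr (Y^T * Z).
Proof.
rewrite /mxtrace; apply: eq_bigr => a _; rewrite mulmx_entry.
by apply: eq_bigr => b _; rewrite mul_delta_entry mxE.
Qed.

(** An entry used in opposite directions: the walk falls apart into two closed walks, the planar
    case. *)
Lemma sum_delta_split Y Z :
  \sum_a \sum_b (Y * delta_mx b a * Z) b a = \tr Y * \tr Z.
Proof.
rewrite exchange_big /mxtrace mulr_suml; apply: eq_bigr => b _.
by rewrite mulr_sumr; apply: eq_bigr => a _; rewrite mul_delta_entry.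
Qed.

Lemma sum_mul_trmx Y Z : \sum_a \sum_b Y b a * Z b a = \tr (Y^T * Z).
Proof.
rewrite /mxtrace; apply: eq_bigr => a _; rewrite mulmx_entry.
by apply: eq_bigr => b _; rewrite mxE.
Qed.

Lemma sum_mul_tr Y Z : \sum_a \sum_b Y b a * Z a b = \tr (Y * Z).
Proof. by rewrite exchange_big /mxtrace; apply: eq_bigr => a _; rewrite mulmx_entry. Qed.

End SquareMatrices.

(** * Closed walks as polynomials in the signs, and their derivatives *)

Section Moments.
Variables (R : realType) (n : nat) (i0 : 'I_n).

Notation signs := (signs n).

Definition signmx (s : signs) : 'M[R]_n := \matrix_(i, j) sgn R s (i, j).
Definition gram (s : signs) : 'M[R]_n := signmx s * (signmx s)^T.

Definition posmx (F : signs -> 'M[R]_n) := forall i j, pos (fun s => F s i j).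
Definition derivmx e (F G : signs -> 'M[R]_n) :=
  forall i j, deriv e (fun s => F s i j) (fun s => G s i j).

Lemma eq_derivmx e F F' G G' :
  F =1 F' -> G =1 G' -> derivmx e F G -> derivmx e F' G'.
Proof.
by move=> FF GG h i j; apply: eq_deriv (h i j) => s; rewrite ?FF ?GG.
Qed.

Lemma posmxM F G : posmx F -> posmx G -> posmx (fun s => F s * G s).
Proof.
move=> hF hG i j.
have h : pos (fun s => \sum_k F s i k * G s k j).
  by apply: pos_sum => k _; exact: posM (hF i k) (hG k j).
by apply: eq_pos h => s; rewrite mulmx_entry.
Qed.

Lemma posmx1 : posmx (fun=> 1).
Proof. by move=> i j; apply: eq_pos (pos_bool R n (i == j)) => s; rewrite mxE. Qed.

Lemma posmx_exp F k : posmx F -> posmx (fun s => F s ^+ k).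
Proof.
move=> hF; elim: k => [|k IH]; first exact: posmx1.
by move=> i j; apply: eq_pos (posmxM hF IH i j) => s; rewrite exprS.
Qed.

Lemma posmx_sign : posmx signmx.
Proof. by move=> i j; apply: eq_pos (pos_sgn R (i, j)) => s; rewrite mxE. Qed.

Lemma posmx_tr F : posmx F -> posmx (fun s => (F s)^T).
Proof. by move=> hF i j; apply: eq_pos (hF j i) => s; rewrite mxE. Qed.

Lemma posmx_gram : posmx gram.
Proof. exact: posmxM posmx_sign (posmx_tr posmx_sign). Qed.

Lemma pos_mxtrace F : posmx F -> pos (fun s => \tr (F s)).
Proof. by move=> hF; apply: pos_sum => i _; exact: hF. Qed.

Lemma derivmxM e F F' G G' : derivmx e F G -> derivmx e F' G' ->
  derivmx e (fun s => F s * F' s) (fun s => G s * F' s + F s * G' s).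
Proof.
move=> h h' i j.
have H := deriv_sum (index_enum 'I_n) (fun k => derivM (h i k) (h' k j)).
apply: eq_deriv H => s; first by rewrite mulmx_entry.
by rewrite mxE !mulmx_entry -big_split.
Qed.

Lemma derivmx_tr e F G : derivmx e F G -> derivmx e (fun s => (F s)^T) (fun s => (G s)^T).
Proof. by move=> h i j; apply: eq_deriv (h j i) => s; rewrite mxE. Qed.

Lemma derivmx_bool e (D : 'I_n -> 'I_n -> bool) :
  derivmx e (fun=> \matrix_(i, j) (D i j)%:R) (fun=> 0).
Proof. by move=> i j; apply: eq_deriv (deriv_bool R e (D i j)) => s; rewrite mxE. Qed.

Lemma derivmx1 e : derivmx e (fun=> 1) (fun=> 0).
Proof. by move=> i j; apply: eq_deriv (deriv_bool R e (i == j)) => s; rewrite mxE. Qed.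

Lemma derivmx_exp e F G k : derivmx e F G ->
  derivmx e (fun s => F s ^+ k) (fun s => \sum_(l < k) F s ^+ l * G s * F s ^+ (k.-1 - l)).
Proof.
move=> h; elim: k => [|k IH].
  by apply: eq_derivmx (derivmx1 e) => s; rewrite ?expr0 ?big_ord0.
apply: eq_derivmx (derivmxM h IH) => s; first by rewrite exprS.
rewrite big_ord_recl expr0 mul1r subn0; congr (_ + _).
rewrite mulr_sumr; apply: eq_bigr => l _ /=.
by rewrite /bump leq0n add1n exprS !mulrA -predn_sub subnS.
Qed.

Lemma derivmx_sign a b : derivmx (a, b) signmx (fun=> delta_mx a b).
Proof.
by move=> i j; apply: eq_deriv (deriv_sgn R (a, b) (i, j)) => s; rewrite mxE // xpair_eqE.
Qed.

Definition dgram (e : 'I_n * 'I_n) (s : signs) : 'M[R]_n :=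
  delta_mx e.1 e.2 * (signmx s)^T + signmx s * delta_mx e.2 e.1.

Lemma derivmx_gram a b : derivmx (a, b) gram (dgram (a, b)).
Proof.
apply: eq_derivmx (derivmxM (derivmx_sign a b) (derivmx_tr (derivmx_sign a b))) => s //=.
by rewrite trmx_delta.
Qed.

Lemma deriv_mxtrace e F G : derivmx e F G ->
  deriv e (fun s => \tr (F s)) (fun s => \tr (G s)).
Proof. by move=> h; apply: deriv_sum => i; exact: h. Qed.

(* The root of a closed walk is free when [b] holds, and pinned at [i0] otherwise. *)
Definition root_mx (b : bool) : 'M[R]_n := \matrix_(i, j) ((i == j) && (b || (i == i0)))%:R.

(** The trace of M^k for a free root, the diagonal entry of M^k at [i0] for a pinned one. A common
    form lets a single induction bound both. *)
Definition closed_walks (x : bool * nat) (s : signs) : R :=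
  \tr (root_mx x.1 * gram s ^+ x.2).

Definition moment (L : seq (bool * nat)) : R :=
  mean (fun s => \prod_(x <- L) closed_walks x s).

Lemma root_mx_true : root_mx true = 1.
Proof. by apply/matrixP => i j; rewrite !mxE andbT. Qed.

Lemma root_mx_false : root_mx false = delta_mx i0 i0.
Proof.
apply/matrixP => i j; rewrite !mxE /=; congr (nat_of_bool _)%:R.
by case: (eqVneq i i0) => [->|_]; rewrite ?andbF ?andbT //= eq_sym.
Qed.

Lemma root_mx_sym b : (root_mx b)^T = root_mx b.
Proof. by apply/matrixP => i j; rewrite !mxE; have [->|] := eqVneq j i. Qed.

Lemma derivmx_root e b : derivmx e (fun=> root_mx b) (fun=> 0).
Proof. exact: derivmx_bool. Qed.

Lemma posmx_root b : posmx (fun=> root_mx b).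
Proof. by move=> i j; apply: eq_pos (pos_bool R n ((i == j) && (b || (i == i0)))) => s; rewrite mxE. Qed.

Lemma posmx_root_compl b : posmx (fun=> 1 - root_mx b).
Proof.
move=> i j; apply: eq_pos (pos_bool R n ((i == j) && ~~ (b || (i == i0)))) => s.
by rewrite !mxE; case: (i == j); case: (b || _) => /=; rewrite ?subr0 ?subrr.
Qed.

Lemma gram_sym s : (gram s)^T = gram s.
Proof. by rewrite trmxM trmxK. Qed.

Lemma pos_closed_walks x : pos (closed_walks x).
Proof. exact: pos_mxtrace (posmxM (posmx_root _) (posmx_exp _ posmx_gram)). Qed.

Lemma closed_walks0 b s : closed_walks (b, 0%N) s = if b then n%:R else 1.
Proof.
rewrite /closed_walks expr0 mulr1; case: b; first by rewrite root_mx_true mxtrace1.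
by rewrite root_mx_false -[delta_mx _ _]mulr1 mxtrace_delta_mul mxE eqxx.
Qed.

(* The walks from [b] to [a] that the edge [(a, b)] closes up. *)
Definition open_walks (b1 : bool) k (s : signs) : 'M[R]_n :=
  (signmx s)^T * gram s ^+ k * root_mx b1.

Lemma closed_walks_open b1 k s :
  closed_walks (b1, k.+1) s =
  \sum_a \sum_b sgn R s (a, b) * open_walks b1 k s b a.
Proof.
rewrite /closed_walks mxtraceMC /= exprS -!mulrA /mxtrace; apply: eq_bigr => a _.
by rewrite mulmx_entry; apply: eq_bigr => b _; rewrite mxE /open_walks -!mulrA.
Qed.

Definition dopen (e : 'I_n * 'I_n) b1 k s : R :=
  ((delta_mx e.2 e.1 * gram s ^+ k +
    (signmx s)^T * \sum_(l < k) gram s ^+ l * dgram e s * gram s ^+ (k.-1 - l))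
     * root_mx b1) e.2 e.1.

Lemma deriv_open a b b1 k :
  deriv (a, b) (fun s => open_walks b1 k s b a) (dopen (a, b) b1 k).
Proof.
have h := derivmxM (derivmxM (derivmx_tr (derivmx_sign a b)) (derivmx_exp k (derivmx_gram a b)))
  (derivmx_root (a, b) b1).
apply: eq_deriv (h b a) => s //=.
by rewrite mulr0 addr0 trmx_delta.
Qed.

(** The partner of the removed edge lies on the same walk. In the opposite direction it splits the
    walk, the case l = 0 coming from the leading factor A^T. In the same direction, at each of [k]
    places, it leaves one walk of half-length [k]. *)
Lemma sum_dopen b1 k s :
  \sum_a \sum_b dopen (a, b) b1 k s =
  \sum_(l < k.+1) closed_walks (true, l : nat) s * closed_walks (b1, k - l)%N s
    + k%:R * closed_walks (b1, k) s.
Proof.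
have e : forall a b, dopen (a, b) b1 k s =
    (1 * delta_mx b a * (gram s ^+ k * root_mx b1)) b a +
    \sum_(l < k) ((((signmx s)^T * gram s ^+ l) * delta_mx a b *
        ((signmx s)^T * gram s ^+ (k.-1 - l) * root_mx b1)) b a +
     (((signmx s)^T * gram s ^+ l * signmx s) * delta_mx b a *
        (gram s ^+ (k.-1 - l) * root_mx b1)) b a).
  move=> a b; rewrite /dopen mulrDl mxE mul1r -mulrA; congr (_ + _).
  rewrite mulr_sumr mulr_suml summxE; apply: eq_bigr => l _.
  by rewrite /dgram /= !(mulrDr, mulrDl) mxE !mulrA.
under eq_bigr do under eq_bigr do rewrite e.
under eq_bigr do rewrite big_split /=.
rewrite big_split /= sum_delta_split mxtrace1.
rewrite big_ord_recl /= closed_walks0 subn0 -addrA; congr (_ + _).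
  by rewrite /closed_walks /= mxtraceMC.
under eq_bigr do rewrite exchange_big /=.
rewrite exchange_big /=.
under eq_bigr => l _.
  under eq_bigr do rewrite big_split /=.
  rewrite big_split /= sum_delta_trmx sum_delta_split.
  over.
rewrite big_split /= addrC; congr (_ + _).
  apply: eq_bigr => l _; rewrite /bump leq0n add1n /closed_walks /= root_mx_true mul1r.
  rewrite -mulrA mxtraceMC -mulrA -/(gram s) -exprSr; congr (_ * _).
  by rewrite mxtraceMC -predn_sub subnS.
rewrite (eq_bigr (fun=> closed_walks (b1, k) s)); last first.
  move=> l _; rewrite trmxM trmxK trmx_exp gram_sym /closed_walks /=.
  rewrite [RHS]mxtraceMC !mulrA -[_ * _ * _^T]mulrA -/(gram s) -exprSr -exprD.
  by congr (\tr (_ ^+ _ * _)); have := ltn_ord l; lia.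
by rewrite sumr_const card_ord mulr_natl.
Qed.

Definition dclosed (e : 'I_n * 'I_n) (x : bool * nat) s : R :=
  \tr (root_mx x.1 * \sum_(l < x.2) gram s ^+ l * dgram e s * gram s ^+ (x.2.-1 - l)).

Lemma deriv_closed a b x : deriv (a, b) (closed_walks x) (dclosed (a, b) x).
Proof.
have h := derivmxM (derivmx_root (a, b) x.1) (derivmx_exp x.2 (derivmx_gram a b)).
by apply: eq_deriv (deriv_mxtrace h) => s //=; rewrite mul0r add0r.
Qed.

(** Freeing the intermediate root only adds monomials, since [1 - root_mx b2] has entries 0 and
    1. *)
Lemma pos_unpin b1 b2 p q :
  pos (fun s => closed_walks (b1, p + q)%N s -
    \tr (root_mx b1 * gram s ^+ p * root_mx b2 * gram s ^+ q)).
Proof.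
have h := posmxM (posmxM (posmxM (posmx_root b1) (posmx_exp p posmx_gram))
  (posmx_root_compl b2)) (posmx_exp q posmx_gram).
apply: eq_pos (pos_mxtrace h) => s /=.
by rewrite mulrBr mulr1 mulrBl mxtraceD raddfN /closed_walks /= exprD mulrA.
Qed.

(** The partner lies on another walk [x]: at each of its [2 * x.2] edges the two walks join into one
    rooted like the first, and forgetting the root of [x] only adds walks. *)
Lemma pos_merge b1 k x :
  pos (fun s => (x.2.*2)%:R * closed_walks (b1, k + x.2)%N s -
    \sum_a \sum_b open_walks b1 k s b a * dclosed (a, b) x s).
Proof.
case: x => b2 m /=.
have e s : \sum_a \sum_b open_walks b1 k s b a * dclosed (a, b) (b2, m) s =
    \sum_(l < m) (\tr (root_mx b1 * gram s ^+ (k + m - l) * root_mx b2 * gram s ^+ l) +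
      \tr (root_mx b1 * gram s ^+ (m.-1 - l) * root_mx b2 * gram s ^+ (l.+1 + k))).
  have d a b : dclosed (a, b) (b2, m) s =
      \sum_(l < m) (((signmx s)^T * gram s ^+ (m.-1 - l) * root_mx b2 * gram s ^+ l) b a +
        (gram s ^+ (m.-1 - l) * root_mx b2 * gram s ^+ l * signmx s) a b).
    rewrite /dclosed mulr_sumr raddf_sum; apply: eq_bigr => l _ /=.
    rewrite /dgram /= !(mulrDr, mulrDl) mxtraceD; congr (_ + _).
      rewrite !mulrA -[X in \tr X]mulrA -[X in \tr X]mulrA mxtraceMC -!mulrA mxtrace_delta_mul.
      by rewrite !mulrA.
    rewrite !mulrA -[X in \tr X]mulrA mxtraceMC -!mulrA mxtrace_delta_mul.
    by rewrite !mulrA.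
  under eq_bigr => a _.
    under eq_bigr => b _.
      rewrite d mulr_sumr; under eq_bigr do rewrite mulrDr.
      over.
    rewrite exchange_big /=; over.
  rewrite exchange_big /=; apply: eq_bigr => l _.
  under eq_bigr do rewrite big_split /=.
  rewrite big_split /= sum_mul_trmx sum_mul_tr /open_walks; congr (_ + _).
    rewrite !trmxM trmxK trmx_exp gram_sym root_mx_sym.
    rewrite !mulrA; congr (\tr (_ * _ * _)).
    rewrite -!mulrA; congr (_ * _); rewrite !mulrA -[_ * _ * _^T]mulrA -/(gram s) -exprSr -exprD.
    by congr (_ ^+ _); have := ltn_ord l; lia.
  rewrite !mulrA mxtraceMC !mulrA -/(gram s) -exprS -!mulrA mxtraceMC -!mulrA -exprD.
  by rewrite !mulrA; congr (\tr (_ * _ ^+ _)); lia.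
have h : pos (fun s => \sum_(l < m)
   ((closed_walks (b1, k + m - l + l)%N s -
       \tr (root_mx b1 * gram s ^+ (k + m - l) * root_mx b2 * gram s ^+ l)) +
    (closed_walks (b1, m.-1 - l + (l.+1 + k))%N s -
      \tr (root_mx b1 * gram s ^+ (m.-1 - l) * root_mx b2 * gram s ^+ (l.+1 + k))))).
  by apply: pos_sum => l _; apply: posD; exact: pos_unpin.
apply: eq_pos h => s; rewrite e.
rewrite (eq_bigr (fun l : 'I_m => closed_walks (b1, k + m)%N s *+ 2 -
   (\tr (root_mx b1 * gram s ^+ (k + m - l) * root_mx b2 * gram s ^+ l) +
      \tr (root_mx b1 * gram s ^+ (m.-1 - l) * root_mx b2 * gram s ^+ (l.+1 + k))))).
  by rewrite sumrB sumr_const card_ord -mulrnA mul2n mulr_natl.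
move=> l _; have lm := ltn_ord l.
have -> : (k + m - l + l = k + m)%N by lia.
have -> : (m.-1 - l + (l.+1 + k) = k + m)%N by lia.
by rewrite mulr2n; ring.
Qed.

End Moments.

(** * Upper bounds for moments of products of closed walks *)

Section MomentBound.
Variables (R : realType) (n : nat) (i0 : 'I_n).

Notation signs := (signs n).
Notation closed_walks := (closed_walks R i0).
Notation moment := (moment R i0).
Notation open_walks := (open_walks R i0).
Notation walk_prod L := (fun s => \prod_(x <- L) closed_walks x s).

Definition main_order (x : bool * nat) : R :=
  n%:R ^+ x.2 * catalan R x.2 * (if x.1 then n%:R else 1).

(** Relative loss of one recursion step: same-direction pairs contribute at most N/n and mergers at
    most 2N(N+1)^4/n, together below 3(N+1)^5/n. *)
Definition error_factor (N : nat) : R := 1 + 3 * N.+1%:R ^+ 5 / n%:R.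

Definition half_length (L : seq (bool * nat)) : nat := \sum_(x <- L) x.2.

Lemma half_length_cons x L : half_length (x :: L) = (x.2 + half_length L)%N.
Proof. exact: big_cons. Qed.

Lemma half_length_cat L L' : half_length (L ++ L') = (half_length L + half_length L')%N.
Proof. exact: big_cat. Qed.

Let n_gt0 : 0 < n%:R :> R.
Proof. by rewrite ltr0n; case: n i0 => // -[]. Qed.

Let n_ge1 : 1 <= n%:R :> R.
Proof. by rewrite ler1n -(ltr0n R). Qed.

Lemma error_factor_ge1 N : 1 <= error_factor N.
Proof. by rewrite lerDl divr_ge0 ?ltW // mulr_ge0 // exprn_ge0. Qed.

Lemma main_order_gt0 x : 0 < main_order x.
Proof. by rewrite !mulr_gt0 ?exprn_gt0 ?catalan_gt0 //; case: ifP. Qed.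

Lemma main_order_prod_gt0 L : 0 < \prod_(x <- L) main_order x.
Proof. by apply: prodr_gt0 => x _; exact: main_order_gt0. Qed.

(** The merged walk has total half-length one less, hence the factor 1/n; if [x] was free, losing
    its root saves yet another n. The Catalan numbers differ by a polynomial factor. *)
Lemma main_order_merge b k x :
  main_order (b, k + x.2)%N <=
  (k.+2%:R * x.2.+1%:R) ^+ 2 / n%:R * (main_order (b, k.+1) * main_order x).
Proof.
case: x => b2 m /=; rewrite /main_order /=.
set e := if b then _ else _; have e_gt0 : 0 < e by rewrite /e; case: ifP.
set e2 := if b2 then _ else _.
have e2_ge1 : 1 <= e2 by rewrite /e2; case: ifP.
have -> : (k.+2%:R * m.+1%:R) ^+ 2 / n%:R *
   (n%:R ^+ k.+1 * catalan R k.+1 * e * (n%:R ^+ m * catalan R m * e2)) =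
   (n%:R ^+ (k + m) * e) * (((k.+2%:R * m.+1%:R) ^+ 2 * (catalan R k.+1 * catalan R m)) * e2).
  by rewrite (exprS _ k) (exprD _ k m); field; rewrite gt_eqF.
rewrite mulrAC; apply: ler_wpM2l; first by rewrite mulr_ge0 ?exprn_ge0 // ltW.
apply: le_trans (catalan_merge _ _ _) _; apply: ler_peMr => //.
by rewrite mulr_ge0 ?exprn_ge0 ?mulr_ge0 // ltW ?catalan_gt0.
Qed.

Fixpoint dwalks (e : 'I_n * 'I_n) (r : seq (bool * nat)) (s : signs) : R :=
  if r is x :: r' then
    dclosed R i0 e x s * walk_prod r' s + closed_walks x s * dwalks e r' s
  else 0.

Lemma deriv_walks a b r : deriv (a, b) (walk_prod r) (dwalks (a, b) r).
Proof.
elim: r => [|x r IH] /=.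
  by apply: eq_deriv (deriv1 _ _) => s; rewrite ?big_nil.
by apply: eq_deriv (derivM (deriv_closed R i0 a b x) IH) => s; rewrite ?big_cons.
Qed.

Lemma pos_walks r : pos (walk_prod r).
Proof. by apply: pos_prod => x; exact: pos_closed_walks. Qed.

(** Integration by parts on the first edge of the first walk. Its partner is on the same walk,
    giving the split and same-direction terms, or on a walk of [r], giving the last term. *)
Lemma moment_rec b k r :
  moment ((b, k.+1) :: r) <=
  \sum_(l < k.+1) moment [:: (true, l : nat), (b, k - l)%N & r] +
    k%:R * moment ((b, k) :: r) +
  mean (fun s => \sum_i \sum_j open_walks b k s j i * dwalks (i, j) r s).
Proof.
rewrite /moment (eq_mean (g := fun s => \sum_i \sum_j
    sgn R s (i, j) * (open_walks b k s j i * walk_prod r s))); last first.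
  move=> s; rewrite big_cons closed_walks_open mulr_suml; apply: eq_bigr => i _.
  by rewrite mulr_suml; apply: eq_bigr => j _; rewrite mulrA.
rewrite mean_sum; under eq_bigr do rewrite mean_sum.
apply: (le_trans (y := \sum_i \sum_j mean (fun s =>
    dopen R i0 (i, j) b k s * walk_prod r s + open_walks b k s j i * dwalks (i, j) r s))).
  apply: ler_sum => i _; apply: ler_sum => j _; apply: mean_ibp.
  exact: derivM (deriv_open R i0 i j b k) (deriv_walks i j r).
under eq_bigr do rewrite -mean_sum.
rewrite -mean_sum -mean_sum -meanZ -!meanD le_eqVlt; apply/orP; left; apply/eqP.
apply: eq_mean => s.
under [LHS]eq_bigr do rewrite big_split /=.
rewrite big_split /=; congr (_ + _).
under [LHS]eq_bigr do rewrite -mulr_suml.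
rewrite -[LHS]mulr_suml sum_dopen mulrDl big_cons mulrA; congr (_ + _).
by rewrite mulr_suml; apply: eq_bigr => l _; rewrite !big_cons mulrA.
Qed.

(** Leibniz over the walks of [r]: the induction moves each treated walk into [pre], and every
    merged product has total half-length [K], where the hypothesis applies. *)
Lemma merge_le N K g b k pre r :
  (forall L, half_length L = K -> moment L <= \prod_(x <- L) main_order x * g) ->
  0 <= g -> (k + half_length pre + half_length r = K)%N -> (K < N)%N ->
  mean (fun s => walk_prod pre s *
    \sum_i \sum_j open_walks b k s j i * dwalks (i, j) r s) <=
  2 * (half_length r)%:R * (N.+1%:R ^+ 4 / n%:R) *
    (main_order (b, k.+1) * (\prod_(x <- pre) main_order x * \prod_(x <- r) main_order x) * g).
Proof.
move=> IH g_ge0; elim: r pre => [|x r IHr] pre hK KN.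
  rewrite /half_length big_nil mulr0 !mul0r (eq_mean (g := fun=> 0)) ?mean_cst // => s.
  by rewrite [X in _ * X]big1 ?mulr0 // => i _; rewrite big1 // => j _ /=; rewrite mulr0.
have hx := half_length_cons x r.
have -> : mean (fun s => walk_prod pre s *
      \sum_i \sum_j open_walks b k s j i * dwalks (i, j) (x :: r) s) =
    mean (fun s => walk_prod (pre ++ r) s *
       \sum_i \sum_j open_walks b k s j i * dclosed R i0 (i, j) x s) +
    mean (fun s => walk_prod (x :: pre) s *
      \sum_i \sum_j open_walks b k s j i * dwalks (i, j) r s).
  rewrite -meanD; apply: eq_mean => s.
  rewrite big_cat big_cons /= -mulrA [closed_walks x s * _]mulrC -[X in _ = _ + X]mulrA -mulrDr.
  congr (_ * _); rewrite !mulr_sumr -big_split; apply: eq_bigr => i _ /=.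
  by rewrite !mulr_sumr -big_split; apply: eq_bigr => j _ /=; ring.
rewrite hx natrD mulrDr (mulrDl (2 * x.2%:R)).
rewrite (mulrDl (2 * x.2%:R * (N.+1%:R ^+ 4 / n%:R))); apply: lerD; last first.
  apply: le_trans (IHr (x :: pre) _ KN) _.
    by rewrite half_length_cons; rewrite hx in hK; lia.
  by rewrite !big_cons le_eqVlt; apply/orP; left; apply/eqP; ring.
apply: (le_trans (y := (x.2.*2)%:R * moment ((b, k + x.2)%N :: pre ++ r))).
  rewrite -subr_ge0 -meanZ -mulN1r -meanZ -meanD; apply: mean_pos.
  apply: eq_pos (posM (pos_walks (pre ++ r)) (pos_merge R i0 b k x)) => s.
  by rewrite big_cons; ring.
have hL : half_length ((b, k + x.2)%N :: pre ++ r) = K.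
  by rewrite half_length_cons half_length_cat /=; rewrite hx in hK; lia.
apply: (le_trans (ler_wpM2l _ (IH _ hL))); first by rewrite ler0n.
rewrite !big_cons big_cat /=.
have -> : (x.2.*2)%:R = 2 * x.2%:R :> R by rewrite -muln2 natrM mulrC.
have h : main_order (b, k + x.2)%N <=
    N.+1%:R ^+ 4 / n%:R * (main_order (b, k.+1) * main_order x).
  apply: le_trans (main_order_merge b k x) _; apply: ler_wpM2r.
    by rewrite mulr_ge0 // ltW // main_order_gt0.
  apply: ler_wpM2r; first by rewrite invr_ge0 ltW.
  rewrite -[4%N]/(2 * 2)%N exprM lerXn2r ?nnegrE ?exprn_ge0 ?mulr_ge0 //.
  rewrite -natrM -natrX ler_nat -mulnn; apply: leq_mul; rewrite hx in hK; lia.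
have ac : 0 <= \prod_(y <- pre) main_order y * \prod_(y <- r) main_order y * g.
  by rewrite !mulr_ge0 // ltW // main_order_prod_gt0.
move: h ac; move: (main_order (b, k + x.2)%N) (main_order (b, k.+1)) (main_order x).
move: (\prod_(_ <- pre) _) (\prod_(_ <- r) _) (N.+1%:R ^+ 4 / n%:R) => a c t u v w h ac.
have -> : 2 * x.2%:R * t * (v * (a * (w * c)) * g) = 2 * x.2%:R * (t * (v * w) * (a * c * g)).
  by ring.
rewrite -[u * _ * g]mulrA; apply: ler_wpM2l; first by rewrite mulr_ge0.
exact: ler_wpM2r.
Qed.

(* Induction on the total length: the planar term reproduces Catalan's
   recursion exactly, all others lose a factor n. *)
Lemma moment_le N L : (half_length L <= N)%N ->
  moment L <= \prod_(x <- L) main_order x * error_factor N ^+ half_length L.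
Proof.
move mE: (half_length L) => m; move: mE.
have g_ge0 K : 0 <= error_factor N ^+ K.
  by rewrite exprn_ge0 // (le_trans ler01) // error_factor_ge1.
(* The inner induction strips walks of length zero, which equal their main order exactly, until the
   first walk has an edge to remove. *)
elim: m L => [|m IHm]; elim=> [|[b [|k]] r IHr] hL mN.
- by rewrite /moment !big_nil expr0 mulr1 (eq_mean (g := fun=> 1)) ?mean_cst // => s; rewrite big_nil.
- have hr : half_length r = 0%N by rewrite -hL half_length_cons.
  rewrite big_cons -mulrA /moment (eq_mean (g := fun s => main_order (b, 0%N) * walk_prod r s)).
    by rewrite meanZ ler_pM2l ?main_order_gt0 //; exact: IHr.
  by move=> s; rewrite big_cons closed_walks0 /main_order /= expr0 !mul1r.
- by move: hL; rewrite half_length_cons.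
- by move: hL; rewrite /half_length big_nil.
- have hr : half_length r = m.+1 by rewrite -hL half_length_cons.
  rewrite big_cons -mulrA /moment (eq_mean (g := fun s => main_order (b, 0%N) * walk_prod r s)).
    by rewrite meanZ ler_pM2l ?main_order_gt0 //; exact: IHr.
  by move=> s; rewrite big_cons closed_walks0 /main_order /= expr0 !mul1r.
have {}hL : (k + half_length r = m)%N by move: hL; rewrite half_length_cons /=; lia.
have IH L : half_length L = m -> moment L <= \prod_(x <- L) main_order x * error_factor N ^+ m.
  by move=> h; apply: IHm => //; exact: ltnW.
have mer := @merge_le N m _ b k [::] r IH (g_ge0 m) _ mN.
rewrite big_nil mul1r in mer.
set g := error_factor N ^+ m in IH mer *.
set Phi := \prod_(x <- r) main_order x in mer *.
have Phi_gt0 : 0 < Phi by exact: main_order_prod_gt0.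
apply: le_trans (moment_rec b k r) _.
have split_le : \sum_(l < k.+1) moment [:: (true, l : nat), (b, k - l)%N & r] <=
    main_order (b, k.+1) * Phi * g.
  apply: (le_trans (y := \sum_(l < k.+1) main_order (true, l : nat) *
     (main_order (b, k - l)%N * Phi) * g)).
    apply: ler_sum => l _; have := ltn_ord l; rewrite ltnS => lk.
    apply: (le_trans (IH _ _)); last by rewrite !big_cons.
    by rewrite !half_length_cons /=; lia.
  rewrite -mulr_suml le_eqVlt; apply/orP; left; apply/eqP; congr (_ * _).
  rewrite /main_order /= -catalan_conv mulr_sumr !mulr_suml; apply: eq_bigr => l _.
  have := ltn_ord l; rewrite ltnS => lk.
  have -> : n%:R ^+ k.+1 = n%:R * (n%:R ^+ l * n%:R ^+ (k - l)) :> R.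
    by rewrite -exprD subnKC // exprS.
  by ring.
have twist_le : k%:R * moment ((b, k) :: r) <= k%:R / n%:R * (main_order (b, k.+1) * Phi * g).
  rewrite -mulrA; apply: ler_wpM2l; first by rewrite ler0n.
  apply: (le_trans (IH _ _)); first by rewrite half_length_cons.
  have h : main_order (b, k) <= n%:R^-1 * main_order (b, k.+1).
    rewrite /main_order /=; move: (catalan_leS R k).
    move: (catalan R k) (catalan R k.+1) => c c' cc'.
    rewrite exprS !mulrA mulVf ?gt_eqF // mul1r.
    apply: ler_wpM2r; first by case: ifP => _; rewrite ?ler01 // ltW.
    by apply: ler_wpM2l; rewrite ?exprn_ge0.
  rewrite big_cons; move: h; move: (main_order (b, k)) (main_order (b, k.+1)) => u v h.
  rewrite -!(mulrA _ Phi) (mulrA n%:R^-1); apply: ler_wpM2r => //.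
  by rewrite mulr_ge0 // ?g_ge0 // ltW.
have {}mer : mean (fun s => \sum_i \sum_j open_walks b k s j i * dwalks (i, j) r s) <=
    2 * (half_length r)%:R * (N.+1%:R ^+ 4 / n%:R) * (main_order (b, k.+1) * Phi * g).
  apply: le_trans (mer _); last by rewrite /half_length big_nil -/(half_length r); lia.
  by apply: ler_mean => s; rewrite big_nil mul1r.
apply: (le_trans (lerD (lerD split_le twist_le) mer)).
rewrite big_cons -/Phi (exprS (error_factor N) m) -/g.
set Q := main_order (b, k.+1) * Phi.
have Q_ge0 : 0 <= Q * g.
  apply: mulr_ge0; last exact: g_ge0.
  by apply: mulr_ge0; apply: ltW => //; exact: main_order_gt0.
rewrite [Q * (_ * g)]mulrCA -{1}[Q * g]mul1r -!mulrDl; apply: ler_wpM2r => //.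
rewrite /error_factor -addrA lerD2l (mulrA (2 * _)) -mulrDl; apply: ler_wpM2r.
  by rewrite invr_ge0 ltW.
have hk : k%:R <= N%:R :> R by rewrite ler_nat; lia.
have hr : (half_length r)%:R <= N%:R :> R by rewrite ler_nat; lia.
have N0 : 0 <= N%:R :> R by rewrite ler0n.
have N1 : 1 <= N.+1%:R ^+ 4 :> R by rewrite exprn_ege1 // ler1n.
rewrite (exprS _ 4); move: (N.+1%:R ^+ 4) N1 => M M1.
rewrite -[N.+1%:R]natr1; nra.
Qed.

End MomentBound.

(** * First returns *)

(** Expansion by the position of the first factor [y]; [x] and [y] need not commute. *)
Lemma exprD_first (R : pzRingType) (x y : R) k :
  (x + y) ^+ k = x ^+ k + \sum_(l < k) x ^+ l * y * (x + y) ^+ (k.-1 - l).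
Proof.
elim: k => [|k IH]; first by rewrite big_ord0 addr0.
rewrite exprS mulrDl {1}IH mulrDr -exprS -addrA; congr (_ + _).
rewrite big_ord_recl expr0 mul1r subn0 addrC; congr (_ + _).
rewrite mulr_sumr; apply: eq_bigr => l _ /=.
by rewrite /bump leq0n add1n exprS !mulrA -predn_sub subnS.
Qed.

Section FirstReturn.
Variables (R : comNzRingType) (n : nat).
Implicit Types A : 'M[R]_n.

Lemma gram_conj A k : A * (A^T * A) ^+ k * A^T = (A * A^T) ^+ k.+1.
Proof.
elim: k => [|k IH]; first by rewrite expr0 mulr1 expr1.
by rewrite exprS [RHS]exprS -IH !mulrA.
Qed.

Definition drop_row (a : 'I_n) A : 'M[R]_n := \matrix_(i, j) (if i == a then 0 else A i j).

Lemma drop_rowE a A : drop_row a A = A - delta_mx a a * A.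
Proof.
apply/matrixP => i j; rewrite mxE [RHS]mxE [X in _ = _ + X]mxE.
rewrite -[delta_mx a a * A]mul1r mulrA mul_delta_entry.
by rewrite mxE; case: eqVneq => [->|_] /=; rewrite ?mul1r ?mul0r ?subrr ?subr0.
Qed.

(* Decompose a closed walk at [a] at its first return to [a]. *)
Lemma first_return A a k :
  ((A * A^T) ^+ k.+1) a a =
  \sum_(l < k.+1) (A * ((drop_row a A)^T * drop_row a A) ^+ l * A^T) a a *
     ((A * A^T) ^+ (k - l)) a a.
Proof.
set D := drop_row a A; set E := delta_mx a a : 'M[R]_n.
have EE : E * E = E by rewrite -mulmxE mul_delta_mx.
have ET : E^T = E by rewrite trmx_delta.
(* Two-step moves avoiding row [a] and those passing through it. The projection [E] then cuts a walk
   at its first visit to [a], and the diagonal entry factors. *)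
have dec : A^T * A = D^T * D + A^T * E * A.
  rewrite /D drop_rowE -/E raddfB /= trmxM ET !(mulrBl, mulrBr) !mulrA.
  by rewrite -[A^T * E * E]mulrA EE subrr subr0 subrK.
rewrite -gram_conj {1}dec exprD_first -dec mulrDr mulrDl mxE big_ord_recr /= subnn expr0.
have -> : (1 : 'M[R]_n) a a = 1 by rewrite mxE eqxx.
rewrite mulr1 addrC; congr (_ + _).
rewrite mulr_sumr mulr_suml summxE; apply: eq_bigr => l _.
have -> : (k - l = (k.-1 - l).+1)%N by have := ltn_ord l; lia.
rewrite -gram_conj.
have -> : A * ((D^T * D) ^+ l * (A^T * E * A) * (A^T * A) ^+ (k.-1 - l)) * A^T =
   (A * (D^T * D) ^+ l * A^T) * E * (A * (A^T * A) ^+ (k.-1 - l) * A^T).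
  by rewrite !mulrA.
by rewrite mul_delta_entry.
Qed.

End FirstReturn.

(** * Lower bounds for the expected number of returns *)

Section ReturnLowerBound.
Variables (R : realType) (n : nat).
Notation signs := (signs n).
Notation posmx := (@posmx R n).

(** Bounding [mean f] alone would not pass to products, whose factors are dependent. A bound under
    every [pos] weight does, since one factor can be absorbed into the weight. *)
Definition dominates (f : signs -> R) (c : R) : Prop :=
  forall h, pos h -> c * mean h <= mean (fun s => h s * f s).

Lemma dominates_cst c : dominates (fun=> c) c.
Proof.
move=> h _; rewrite -meanZ le_eqVlt; apply/orP; left; apply/eqP.
by apply: eq_mean => s; rewrite mulrC.
Qed.

Lemma eq_dominates f g c : f =1 g -> dominates f c -> dominates g c.
Proof.
move=> fg hf h ph; apply: le_trans (hf h ph) _; rewrite le_eqVlt; apply/orP; left; apply/eqP.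
by apply: eq_mean => s; rewrite fg.
Qed.

Lemma dominates_le f c c' : c' <= c -> dominates f c -> dominates f c'.
Proof.
by move=> cc hf h ph; apply: le_trans (hf h ph); apply: ler_wpM2r => //; exact: mean_pos.
Qed.

Lemma dominates_pos f : pos f -> dominates f 0.
Proof. by move=> pf h ph; rewrite mul0r; apply: mean_pos; exact: posM. Qed.

Lemma dominatesD f g c d : dominates f c -> dominates g d ->
  dominates (fun s => f s + g s) (c + d).
Proof.
move=> hf hg h ph; rewrite mulrDl.
have -> : mean (fun s => h s * (f s + g s)) = mean (fun s => h s * f s + h s * g s).
  by apply: eq_mean => s; rewrite mulrDr.
by rewrite meanD; exact: lerD (hf h ph) (hg h ph).
Qed.

Lemma dominates_sum (I : Type) (r : seq I) (Q : pred I) (F : I -> signs -> R) c :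
  (forall i, Q i -> dominates (F i) (c i)) ->
  dominates (fun s => \sum_(i <- r | Q i) F i s) (\sum_(i <- r | Q i) c i).
Proof.
move=> hF; elim: r => [|i r IH].
  by rewrite big_nil; apply: eq_dominates (dominates_cst 0) => s; rewrite big_nil.
have [Qi|Qi] := boolP (Q i); last first.
  by rewrite big_cons (negPf Qi); apply: eq_dominates IH => s; rewrite big_cons (negPf Qi).
rewrite big_cons Qi; apply: eq_dominates (dominatesD (hF i Qi) IH) => s.
by rewrite big_cons Qi.
Qed.

Lemma dominatesM f g c d : pos f -> 0 <= d -> dominates f c -> dominates g d ->
  dominates (fun s => f s * g s) (c * d).
Proof.
move=> pf d0 hf hg h ph.
have -> : mean (fun s => h s * (f s * g s)) = mean (fun s => (h s * f s) * g s).
  by apply: eq_mean => s; rewrite mulrA.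
apply: le_trans (hg _ (posM ph pf)).
by rewrite [c * d]mulrC -mulrA; apply: ler_wpM2l => //; exact: hf.
Qed.

(* [F] is a sign matrix restricted to the rows [S] and columns [S']. *)
Definition sign_block (S S' : {set 'I_n}) (F : signs -> 'M[R]_n) : Prop :=
  posmx F /\ forall s i j, F s i j * F s i j = ((i \in S) && (j \in S'))%:R.

Lemma sign_block_tr S S' F : sign_block S S' F -> sign_block S' S (fun s => (F s)^T).
Proof.
by move=> [pF hF]; split; [exact: posmx_tr | move=> s i j; rewrite mxE hF andbC].
Qed.

Lemma sign_block_drop S S' F a :
  sign_block S S' F -> sign_block (S :\ a) S' (fun s => drop_row a (F s)).
Proof.
move=> [pF hF]; split=> [i j|s i j].
  have [ia|ia] := eqVneq i a.
    by apply: eq_pos (pos0 _ _) => s; rewrite mxE ia eqxx.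
  by apply: eq_pos (pF i j) => s; rewrite mxE (negPf ia).
by rewrite !mxE !inE; case: eqVneq => [_|_] /=; rewrite ?mulr0 ?hF.
Qed.

Lemma sign_block_sign : sign_block [set: 'I_n] [set: 'I_n] (@signmx R n).
Proof.
by split=> [|s i j]; [exact: posmx_sign | rewrite !mxE sgn_sqr !inE].
Qed.

(** Cut at the first return to [a]. An excursion leaving and returning by the same edge to a column
    b contributes sign squared 1 times a closed walk at b in the transposed block without row [a].
    Each level loses at most one row or column, so at least [N - k] choices remain throughout, and
    the Catalan convolution sums the cases. *)
Lemma sign_block_dominates k N S S' F a :
  sign_block S S' F -> (N <= #|S|)%N -> (N <= #|S'|)%N -> a \in S ->
  dominates (fun s => ((F s * (F s)^T) ^+ k) a a) (catalan R k * (N - k)%:R ^+ k).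
Proof.
have [m] := ubnP k; elim: m k N S S' F a => // m IHm [|k] N S S' F a km hF NS NS' aS.
  by apply: eq_dominates (dominates_cst _) => s; rewrite !expr0 mxE eqxx /catalan mul1r.
have pMk G j : posmx G -> posmx (fun s => (G s * (G s)^T) ^+ j).
  by move=> pG; apply: posmx_exp; apply: posmxM => //; exact: posmx_tr.
pose D s := drop_row a (F s).
have hD : sign_block S' (S :\ a) (fun s => (D s)^T).
  by apply: sign_block_tr; exact: sign_block_drop.
pose G l s := ((D s)^T * D s) ^+ l.
have pG l : posmx (G l).
  have h := pMk (fun s => (D s)^T) l hD.1.
  by move=> i j; apply: eq_pos (h i j) => s; rewrite trmxK.
pose q := (N - k.+1)%N.
have step l : (l <= k)%N ->
    dominates (fun s => (F s * G l s * (F s)^T) a a) (N%:R * (catalan R l * q%:R ^+ l)).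
  move=> lk.
  have diag : dominates (fun s => \sum_(b in S') G l s b b)
      (\sum_(b in S') catalan R l * q%:R ^+ l).
    apply: dominates_sum => b bS'.
    have h := IHm l N.-1 S' (S :\ a) (fun s => (D s)^T) b _ hD _ _ bS'.
    apply: (@eq_dominates (fun s => (((D s)^T * ((D s)^T)^T) ^+ l) b b)).
      by move=> s; rewrite trmxK.
    apply: dominates_le (h _ _ _); first last.
    - by have := cardsD1 a S; rewrite aS; lia.
    - by lia.
    - by lia.
    apply: ler_wpM2l; first by rewrite ltW // catalan_gt0.
    by apply: lerXn2r; rewrite ?nnegrE ?ler0n // ler_nat /q; lia.
  (* Excursions returning by a different edge are monomials with coefficient 1, hence may be
     discarded from below. *)
  have off : pos (fun s => (F s * G l s * (F s)^T) a a - \sum_(b in S') G l s b b).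
    have h : pos (fun s => \sum_b \sum_(c | c != b) F s a c * G l s c b * F s a b).
      apply: pos_sum => b _; apply: pos_sum => c _.
      exact: posM (posM (hF.1 a c) (pG l c b)) (hF.1 a b).
    apply: eq_pos h => s; rewrite mulmx_entry.
    rewrite [X in _ - X]big_mkcond -sumrB; apply: eq_bigr => b _.
    rewrite mulmx_entry mxE mulr_suml [X in _ = X - _](bigD1 b) //= addrC.
    rewrite mulrAC [F s a b * F s a b]hF.2 aS /=.
    by case: ifP => _; rewrite ?mul1r ?mul0r ?addrK ?addr0 ?subr0.
  have := dominatesD diag (dominates_pos off).
  rewrite addr0 => /(eq_dominates (g := fun s => (F s * G l s * (F s)^T) a a)) h.
  apply: dominates_le (h _) => [|s]; last by rewrite addrC subrK.
  rewrite sumr_const -[_ *+ #|S'|]mulr_natl; apply: ler_wpM2r; last by rewrite ler_nat.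
  by rewrite mulr_ge0 ?exprn_ge0 // ltW // catalan_gt0.
have term (l : 'I_k.+1) : dominates
    (fun s => (F s * G l s * (F s)^T) a a * ((F s * (F s)^T) ^+ (k - l)) a a)
    ((N%:R * (catalan R l * q%:R ^+ l)) * (catalan R (k - l) * q%:R ^+ (k - l))).
  have lk : (l <= k)%N by rewrite -ltnS.
  apply: dominatesM => //.
  - exact: (posmxM (posmxM hF.1 (pG l)) (posmx_tr hF.1)).
  - by rewrite mulr_ge0 ?exprn_ge0 // ltW // catalan_gt0.
  - exact: step.
  apply: dominates_le (IHm (k - l)%N N S S' F a _ hF NS NS' aS); last by lia.
  apply: ler_wpM2l; first by rewrite ltW // catalan_gt0.
  by apply: lerXn2r; rewrite ?nnegrE ?ler0n // ler_nat /q; lia.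
have h := dominates_sum (index_enum 'I_k.+1) (Q := xpredT) (fun l _ => term l).
apply: dominates_le (eq_dominates _ h) => [|s]; last by rewrite first_return.
rewrite -catalan_conv mulr_suml; apply: ler_sum => l _.
have lk : (l <= k)%N by rewrite -ltnS.
have -> : q%:R ^+ k.+1 = q%:R * (q%:R ^+ l * q%:R ^+ (k - l)) :> R.
  by rewrite -exprD subnKC // exprS.
have cc : 0 <= catalan R l * catalan R (k - l) * (q%:R ^+ l * q%:R ^+ (k - l)).
  by rewrite !mulr_ge0 ?exprn_ge0 // ltW // catalan_gt0.
have qN : q%:R <= N%:R :> R by rewrite ler_nat /q leq_subr.
move: (q%:R ^+ l) (q%:R ^+ (k - l)) cc => u v cc.
by have := ler_wpM2r cc qN; lra.
Qed.

Lemma mean_return_ge k (a : 'I_n) :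
  catalan R k * (n - k)%:R ^+ k <= mean (fun s => (gram R s ^+ k) a a).
Proof.
have [nT aT] : (n <= #|[set: 'I_n]|)%N /\ a \in [set: 'I_n] by rewrite cardsT card_ord inE.
have := sign_block_dominates k sign_block_sign nT nT aT (pos1 R n).
rewrite mean_cst mulr1 => /le_trans; apply; rewrite le_eqVlt; apply/orP; left; apply/eqP.
by apply: eq_mean => s; rewrite mul1r.
Qed.

End ReturnLowerBound.

(** * Operator norm and entangled value *)

Section Inner.
Variable R : realType.

Lemma innerE d (u v : 'rV[R]_d) : inner u v = (u *m v^T) 0 0.
Proof. by rewrite mxE; apply: eq_bigr => k _; rewrite mxE. Qed.

Lemma innerC d (u v : 'rV[R]_d) : inner u v = inner v u.
Proof. by apply: eq_bigr => k _; rewrite mulrC. Qed.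

Lemma innerBl d (u u' v : 'rV[R]_d) : inner (u - u') v = inner u v - inner u' v.
Proof. by rewrite !innerE mulmxBl !mxE. Qed.

Lemma innerZl d c (u v : 'rV[R]_d) : inner (c *: u) v = c * inner u v.
Proof. by rewrite !innerE -scalemxAl mxE. Qed.

Lemma innerZr d c (u v : 'rV[R]_d) : inner u (c *: v) = c * inner u v.
Proof. by rewrite innerC innerZl innerC. Qed.

Lemma innerBr d (u v v' : 'rV[R]_d) : inner u (v - v') = inner u v - inner u v'.
Proof. by rewrite innerC innerBl !(innerC u). Qed.

Lemma inner_ge0 d (u : 'rV[R]_d) : 0 <= inner u u.
Proof. by apply: sumr_ge0 => k _; rewrite -expr2 sqr_ge0. Qed.

Lemma inner_row_mx d d' (a c : 'rV[R]_d) (b e : 'rV[R]_d') :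
  inner (row_mx a b) (row_mx c e) = inner a c + inner b e.
Proof. by rewrite !innerE tr_row_mx mul_row_col mxE. Qed.

Lemma cauchy_schwarz d (u v : 'rV[R]_d) : inner u v ^+ 2 <= inner u u * inner v v.
Proof.
have h : 0 <= \sum_i \sum_j (u 0 i * v 0 j - u 0 j * v 0 i) ^+ 2.
  by apply: sumr_ge0 => i _; apply: sumr_ge0 => j _; exact: sqr_ge0.
have e : \sum_i \sum_j (u 0 i * v 0 j - u 0 j * v 0 i) ^+ 2 =
    2 * (inner u u * inner v v - inner u v ^+ 2).
  have -> : 2 * (inner u u * inner v v - inner u v ^+ 2) =
     inner u u * inner v v + inner v v * inner u u - 2 * (inner u v * inner u v) by ring.
  rewrite {1 2 3 4 5 6}/inner !big_distrlr /= mulr_sumr -big_split /= -sumrB.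
  apply: eq_bigr => i _; rewrite mulr_sumr -big_split /= -sumrB.
  by apply: eq_bigr => j _; ring.
by rewrite e pmulr_rge0 // subr_ge0 in h.
Qed.

Lemma inner_young d (c : R) (u v : 'rV[R]_d) : 0 < c ->
  2 * inner u v <= c * inner u u + c^-1 * inner v v.
Proof.
move=> c0; rewrite /inner !mulr_sumr -big_split /=; apply: ler_sum => k _.
have : 0 <= c^-1 * (c * u 0 k - v 0 k) ^+ 2 by rewrite mulr_ge0 ?sqr_ge0 // invr_ge0 ltW.
have -> : c^-1 * (c * u 0 k - v 0 k) ^+ 2 =
  c * (u 0 k * u 0 k) + c^-1 * (v 0 k * v 0 k) - 2 * (u 0 k * v 0 k).
  by field; rewrite gt_eqF.
by rewrite subr_ge0.
Qed.

(** The Frobenius norm bounds the operator norm, by Cauchy-Schwarz in each column. *)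
Lemma inner_mulmx_le d d' (x : 'rV[R]_d) (B : 'M[R]_(d, d')) :
  inner (x *m B) (x *m B) <= inner x x * \tr (B *m B^T).
Proof.
have -> : \tr (B *m B^T) = \sum_j inner (\row_i B i j) (\row_i B i j).
  rewrite /mxtrace /inner exchange_big; apply: eq_bigr => i _; rewrite mxE.
  by apply: eq_bigr => j _; rewrite !mxE.
rewrite mulr_sumr; apply: ler_sum => j _.
have -> : (x *m B) 0 j = inner x (\row_i B i j).
  by rewrite mxE; apply: eq_bigr => i _; rewrite mxE.
by rewrite -expr2; exact: cauchy_schwarz.
Qed.

End Inner.

Section OperatorNorm.
Variables (R : realType) (n : nat).
Implicit Types (A : 'M[R]_n) (x : 'rV[R]_n).

Lemma inner_gram_double A x j :
  inner (x *m (A * A^T) ^+ j) (x *m (A * A^T) ^+ j) = inner (x *m (A * A^T) ^+ (j + j)) x.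
Proof.
rewrite !innerE trmx_mul trmx_exp trmxM trmxK exprD -!mulmxE !mulmxA.
by [].
Qed.

Lemma inner_gram1 A x : inner (x *m (A * A^T) ^+ 1) x = inner (x *m A) (x *m A).
Proof. by rewrite expr1 !innerE trmx_mul -mulmxE !mulmxA. Qed.

Definition op_norm_sq_le A (t : R) := forall x, inner (x *m A) (x *m A) <= t * inner x x.

(** No spectral decomposition: by Cauchy-Schwarz f(j)^2 <= |x|^2 f(j+1) for f(j) = (x M^(2^j), x).
    Iterating reaches the exponent 2^q, where the Frobenius bound produces the trace. This is why
    the exponents are powers of 2. *)
Lemma op_norm_trace A t q : 0 <= t ->
  \tr ((A * A^T) ^+ (2 ^ q)) <= t ^+ (2 ^ q) -> op_norm_sq_le A t.
Proof.
move=> t0 htr x.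
pose f j := inner (x *m (A * A^T) ^+ (2 ^ j)) x.
have fS j : f j ^+ 2 <= inner x x * f j.+1.
  rewrite /f; apply: le_trans (cauchy_schwarz _ _) _.
  by rewrite inner_gram_double addnn -mul2n -expnS mulrC.
have f0 j : 0 <= f j.
  case: j => [|j]; rewrite /f; first by rewrite expn0 inner_gram1 inner_ge0.
  by rewrite expnS mul2n -addnn -inner_gram_double inner_ge0.
have x0 := inner_ge0 x.
have iter j : f 0 ^+ (2 ^ j) <= inner x x ^+ (2 ^ j).-1 * f j.
  elim: j => [|j IH]; first by rewrite expn0 expr0 mul1r expr1.
  rewrite expnS mulnC exprM.
  apply: (le_trans (y := (inner x x ^+ (2 ^ j).-1 * f j) ^+ 2)).
    by rewrite lerXn2r ?nnegrE // ?exprn_ge0 ?mulr_ge0 ?exprn_ge0.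
  rewrite exprMn -exprM.
  apply: (le_trans (ler_wpM2l _ (fS j))); first by rewrite exprn_ge0.
  rewrite mulrA -exprSr le_eqVlt; apply/orP; left; apply/eqP; congr (_ ^+ _ * _).
  by have := expn_gt0 2 j; lia.
have last_le : f q <= inner x x * t ^+ (2 ^ q).
  apply: le_trans (ler_wpM2l x0 htr); case: q {htr} => [|j].
    by rewrite /f expn0 inner_gram1 expr1; exact: inner_mulmx_le.
  rewrite /f expnS mul2n -addnn -inner_gram_double.
  apply: le_trans (inner_mulmx_le _ _) _.
  by rewrite trmx_exp trmxM trmxK mulmxE -exprD.
have := le_trans (iter q) (ler_wpM2l (exprn_ge0 _ x0) last_le).
rewrite mulrA -exprSr prednK ?expn_gt0 // -exprMn /f expn0 inner_gram1 mulrC.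
by rewrite ler_pXn2r ?nnegrE ?expn_gt0 ?mulr_ge0 ?inner_ge0.
Qed.

Definition bilinear_value d A (u v : 'I_n -> 'rV[R]_d) : R :=
  \sum_(i < n) \sum_(j < n) A i j * inner (u i) (v j).

Lemma bilinear_valueBl d A (u u' v : 'I_n -> 'rV[R]_d) :
  bilinear_value A (fun i => u i - u' i) v = bilinear_value A u v - bilinear_value A u' v.
Proof.
rewrite /bilinear_value -sumrB; apply: eq_bigr => i _; rewrite -sumrB.
by apply: eq_bigr => j _; rewrite innerBl mulrBr.
Qed.

Lemma bilinear_valueBr d A (u v v' : 'I_n -> 'rV[R]_d) :
  bilinear_value A u (fun j => v j - v' j) = bilinear_value A u v - bilinear_value A u v'.
Proof.
rewrite /bilinear_value -sumrB; apply: eq_bigr => i _; rewrite -sumrB.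
by apply: eq_bigr => j _; rewrite innerBr mulrBr.
Qed.

(** In each coordinate of the vectors the form is an ordinary bilinear form of A, to which the norm
    bound and the weighted AM-GM inequality apply. *)
Lemma bilinear_value_young d A t c (u v : 'I_n -> 'rV[R]_d) :
  op_norm_sq_le A t -> 0 < c ->
  2 * bilinear_value A u v <=
    c * t * (\sum_i inner (u i) (u i)) + c^-1 * (\sum_j inner (v j) (v j)).
Proof.
move=> hA c0.
have -> : bilinear_value A u v =
    \sum_(k < d) inner ((\row_i u i 0 k) *m A) (\row_j v j 0 k).
  rewrite /bilinear_value.
  transitivity (\sum_j \sum_i \sum_(k < d) u i 0 k * A i j * v j 0 k).
    rewrite exchange_big; apply: eq_bigr => j _; apply: eq_bigr => i _.
    by rewrite mulr_sumr; apply: eq_bigr => k _; ring.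
  transitivity (\sum_j \sum_(k < d) \sum_i u i 0 k * A i j * v j 0 k).
    by apply: eq_bigr => j _; rewrite exchange_big.
  rewrite exchange_big; apply: eq_bigr => k _; apply: eq_bigr => j _.
  by rewrite !mxE mulr_suml; apply: eq_bigr => i _; rewrite mxE.
have swap (w : 'I_n -> 'rV[R]_d) : \sum_i inner (w i) (w i) =
    \sum_(k < d) inner (\row_i w i 0 k) (\row_i w i 0 k).
  rewrite exchange_big; apply: eq_bigr => k _; apply: eq_bigr => i _.
  by rewrite !mxE.
rewrite !swap !mulr_sumr -big_split; apply: ler_sum => k _ /=.
apply: le_trans (inner_young _ _ c0) _; rewrite lerD2r -mulrA.
by apply: ler_wpM2l; [exact: ltW | exact: hA].
Qed.

Lemma entangled_value_le A t : (0 < n)%N -> 0 < t -> op_norm_sq_le A (t ^+ 2) ->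
  entangled_value A <= t / n%:R.
Proof.
move=> n0 t0 hA; have nR : 0 < n%:R :> R by rewrite ltr0n.
apply: ge_sup; first exact: (has_sup_xor_correlations A).1.
move=> _ [d [u [v [hu hv ->]]]].
(* With this weight both terms of the bound equal t n. *)
have tV : 0 < t^-1 by rewrite invr_gt0.
have := bilinear_value_young u v hA tV.
have hs (w : 'I_n -> 'rV[R]_d) :
    (forall i, unit_vector (w i)) -> \sum_i inner (w i) (w i) = n%:R.
  by move=> hw; rewrite (eq_bigr (fun=> 1)) ?sumr_const ?card_ord // => i _; exact: hw.
rewrite (hs u hu) (hs v hv) => h.
have {}h : bilinear_value A u v <= t * n%:R.
  have e : t^-1 * t ^+ 2 = t by field; rewrite gt_eqF.
  by rewrite e invrK in h; lra.
rewrite /xor_correlation -/(bilinear_value A u v).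
apply: (le_trans (ler_wpM2l _ h)); first by rewrite invr_ge0 exprn_ge0 // ltW.
by rewrite le_eqVlt; apply/orP; left; apply/eqP; field; rewrite gt_eqF.
Qed.

(* Each vector is completed to a unit vector in its own extra coordinate, which
   does not affect the cross inner products. *)
Lemma entangled_value_ge d A (u v : 'I_n -> 'rV[R]_d) :
  (forall i, inner (u i) (u i) <= 1) -> (forall j, inner (v j) (v j) <= 1) ->
  (n%:R ^+ 2)^-1 * bilinear_value A u v <= entangled_value A.
Proof.
move=> hu hv.
pose pad (w : 'rV[R]_d) : 'rV[R]_1 := const_mx (Num.sqrt (1 - inner w w)).
pose u' i := row_mx (u i) (row_mx (pad (u i)) (0 : 'rV[R]_1)).
pose v' j := row_mx (v j) (row_mx (0 : 'rV[R]_1) (pad (v j))).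
have inner0 (w : 'rV[R]_1) : inner 0 w = 0 by rewrite /inner big_ord1 mxE mul0r.
have inner0r (w : 'rV[R]_1) : inner w 0 = 0 by rewrite innerC inner0.
have pad_inner w : inner w w <= 1 -> inner (pad w) (pad w) = 1 - inner w w.
  by move=> hw; rewrite {1}/inner big_ord1 !mxE -expr2 sqr_sqrtr // subr_ge0.
apply: ub_le_sup; first exact: (has_sup_xor_correlations A).2.
exists _, u', v'; split=> [i|j|].
- by rewrite /unit_vector /u' !inner_row_mx pad_inner // inner0 addr0 subrKC.
- by rewrite /unit_vector /v' !inner_row_mx pad_inner // inner0 add0r subrKC.
congr (_ * _); apply: eq_bigr => i _; apply: eq_bigr => j _.
by rewrite /u' /v' !inner_row_mx inner0 inner0r !addr0.
Qed.

End OperatorNorm.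

(** * A nearly optimal strategy from powers of the Gram matrix *)

Section PowerIteration.
Variables (R : realType) (n : nat).
Implicit Types (A : 'M[R]_n).

(** Here [c] is min(1, 1/sqrt x): it shortens a vector of squared length [x] to length at most 1,
    and the squared displacement is at most the squared deviation of [x] from 1. *)
Lemma truncation (x : R) : 0 <= x ->
  exists c : R, [/\ 0 <= c, c ^+ 2 * x <= 1 & (1 - c) ^+ 2 * x <= (x - 1) ^+ 2].
Proof.
move=> x0; case: (leP x 1) => x1.
  by exists 1; split; rewrite ?expr1n ?mul1r // subrr expr0n mul0r sqr_ge0.
pose r := Num.sqrt x.
have r2 : r ^+ 2 = x by rewrite sqr_sqrtr.
have r1 : 1 < r by rewrite -sqrtr1 ltr_sqrt ?(lt_trans ltr01).
have r0 : 0 < r by apply: lt_trans r1; exact: ltr01.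
exists r^-1; split; first by rewrite invr_ge0 ltW.
  by rewrite -r2 exprVn mulVf // expf_neq0 // gt_eqF.
have -> : (1 - r^-1) ^+ 2 * x = (r - 1) ^+ 2 by rewrite -r2; field; rewrite gt_eqF.
rewrite -r2 -subr_ge0 (_ : _ - _ = (r - 1) ^+ 2 * (r * (r + 2))); last by ring.
by apply: mulr_ge0; [exact: sqr_ge0 | apply: mulr_ge0; lra].
Qed.

(* The diagonal entries are the squared lengths of the vectors of the strategy
   below, and [a] is their expected value. *)
Definition deviation (a : R) m A : R := \sum_i (((A * A^T) ^+ m) i i / a - 1) ^+ 2.

(** Cauchy-Schwarz in the weighted form y <= (z + y^2/z)/2. *)
Lemma sum_abs_le (tau : 'I_n -> R) z : 0 < z ->
  \sum_i (tau i - 1) ^+ 2 <= z ^+ 2 * n%:R -> \sum_i `|tau i - 1| <= z * n%:R.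
Proof.
move=> z0 h.
have : \sum_i `|tau i - 1| <= \sum_i (z + z^-1 * (tau i - 1) ^+ 2) / 2.
  apply: ler_sum => i _; rewrite -real_normK ?num_real //; set y := `|_|.
  have : 0 <= z^-1 * (y - z) ^+ 2 by rewrite mulr_ge0 ?sqr_ge0 // invr_ge0 ltW.
  have -> : z^-1 * (y - z) ^+ 2 = z^-1 * y ^+ 2 - 2 * y + z by field; rewrite gt_eqF.
  by lra.
rewrite -mulr_suml big_split /= sumr_const card_ord -[_ *+ n]mulr_natr -mulr_sumr.
move/le_trans; apply.
have : z^-1 * (\sum_i (tau i - 1) ^+ 2) <= z^-1 * (z ^+ 2 * n%:R).
  by apply: ler_wpM2l => //; rewrite invr_ge0 ltW.
have -> : z^-1 * (z ^+ 2 * n%:R) = z * n%:R by field; rewrite gt_eqF.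
by lra.
Qed.

(* The rows of M^k and of A^T M^k (M = A A^T) are nearly of constant length, and
   the value they give is the sum of the squared lengths of the latter. *)
Lemma power_iteration_value A k (a b t z : R) :
  (0 < n)%N -> 0 < a -> 0 < b -> 0 < t -> 0 < z <= 1 -> op_norm_sq_le A (t ^+ 2) ->
  deviation a k.*2 A <= z ^+ 2 * n%:R ->
  deviation b k.*2.+1 A^T <= z ^+ 2 * n%:R ->
  n%:R^-1 * (Num.sqrt (b / a) * (1 - z) - 3 * t * z) <= entangled_value A.
Proof.
move=> n0 a0 b0 t0 /andP[z0 z1] hA; set M := A * A^T.
have nR : 0 < n%:R :> R by rewrite ltr0n.
pose X i := row i (M ^+ k); pose Y j := row j (A^T * M ^+ k).
have MT : M^T = M by rewrite trmxM trmxK.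
have XX i : inner (X i) (X i) = (M ^+ k.*2) i i.
  rewrite /inner -addnn exprD mulmx_entry; apply: eq_bigr => l _.
  by rewrite !mxE -{2}MT -trmx_exp mxE.
have YY j : inner (Y j) (Y j) = ((A^T * A) ^+ k.*2.+1) j j.
  have := gram_conj A^T k.*2; rewrite trmxK -/M -addnn exprD addnn => <-.
  have -> : A^T * (M ^+ k * M ^+ k) * A = (A^T * M ^+ k) * (A^T * M ^+ k)^T.
    by rewrite trmxM trmxK trmx_exp MT !mulrA.
  by rewrite mulmx_entry /inner; apply: eq_bigr => l _; rewrite [in RHS]mxE !mxE.
rewrite /deviation trmxK.
pose tau i := inner (X i) (X i) / a; pose tau' j := inner (Y j) (Y j) / b.
rewrite (eq_bigr (fun i => (tau i - 1) ^+ 2)) => [hX|i _]; last by rewrite /tau XX.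
rewrite (eq_bigr (fun j => (tau' j - 1) ^+ 2)) => [hY|j _]; last by rewrite /tau' YY.
pose al := Num.sqrt a; pose be := Num.sqrt b.
have al0 : 0 < al by rewrite sqrtr_gt0.
have be0 : 0 < be by rewrite sqrtr_gt0.
have al2 : al ^+ 2 = a by rewrite sqr_sqrtr // ltW.
have be2 : be ^+ 2 = b by rewrite sqr_sqrtr // ltW.
pose u0 i := al^-1 *: X i; pose v0 j := be^-1 *: Y j.
have uu i : inner (u0 i) (u0 i) = tau i.
  by rewrite innerZl innerZr /tau -al2; field; rewrite gt_eqF.
have vv j : inner (v0 j) (v0 j) = tau' j.
  by rewrite innerZl innerZr /tau' -be2; field; rewrite gt_eqF.
have tau_ge0 i : 0 <= tau i by rewrite -uu inner_ge0.
have tau'_ge0 i : 0 <= tau' i by rewrite -vv inner_ge0.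
have [c hc] := choice (fun i => truncation (tau_ge0 i)).
have [c' hc'] := choice (fun i => truncation (tau'_ge0 i)).
pose u i := c i *: u0 i; pose v j := c' j *: v0 j.
have hu i : inner (u i) (u i) <= 1.
  by rewrite innerZl innerZr uu mulrA -expr2; case: (hc i).
have hv j : inner (v j) (v j) <= 1.
  by rewrite innerZl innerZr vv mulrA -expr2; case: (hc' j).
have Du : \sum_i inner (u0 i - u i) (u0 i - u i) <= z ^+ 2 * n%:R.
  apply: le_trans hX; apply: ler_sum => i _.
  have -> : u0 i - u i = (1 - c i) *: u0 i by rewrite scalerBl scale1r.
  by rewrite innerZl innerZr uu mulrA -expr2; case: (hc i).
have Dv : \sum_i inner (v0 i - v i) (v0 i - v i) <= z ^+ 2 * n%:R.
  apply: le_trans hY; apply: ler_sum => i _.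
  have -> : v0 i - v i = (1 - c' i) *: v0 i by rewrite scalerBl scale1r.
  by rewrite innerZl innerZr vv mulrA -expr2; case: (hc' i).
have Su0 : \sum_i inner (u0 i) (u0 i) <= 2 * n%:R.
  have := sum_abs_le z0 hX.
  have : \sum_i inner (u0 i) (u0 i) <= \sum_i (1 + `|tau i - 1|).
    by apply: ler_sum => i _; rewrite uu -lerBlDl ler_norm.
  rewrite big_split /= sumr_const card_ord.
  by have := ler_wpM2r (ltW nR) z1; lra.
have Sv : \sum_i inner (v i) (v i) <= n%:R.
  apply: (le_trans (y := \sum_(i < n) 1)); first by apply: ler_sum => i _.
  by rewrite sumr_const card_ord.
have Stau' : (1 - z) * n%:R <= \sum_j tau' j.
  have := sum_abs_le z0 hY.
  have : \sum_(j < n) (1 - `|tau' j - 1|) <= \sum_j tau' j.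
    by apply: ler_sum => j _; have := ler_norm (- (tau' j - 1)); rewrite normrN; lra.
  rewrite sumrB sumr_const card_ord; lra.
(* The j-th row of A^T M^k is the combination of the rows of M^k with coefficients A i j, so the sum
   over i collapses to a squared length. *)
have main : bilinear_value A u0 v0 = Num.sqrt (b / a) * \sum_j tau' j.
  have -> : Num.sqrt (b / a) = be / al.
    by rewrite sqrtrM ?ltW // sqrtrV // ltW.
  rewrite /bilinear_value exchange_big mulr_sumr; apply: eq_bigr => j _.
  have Yj : inner (Y j) (Y j) = \sum_i A i j * inner (X i) (Y j).
    rewrite {1}/inner (eq_bigr (fun l => \sum_i A i j * (X i 0 l * Y j 0 l))).
      by rewrite exchange_big; apply: eq_bigr => i _; rewrite mulr_sumr.
    move=> l _; rewrite {1}/Y mxE mulmx_entry mulr_suml; apply: eq_bigr => i _.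
    by rewrite /X !mxE mulrA.
  rewrite (eq_bigr (fun i => al^-1 * be^-1 * (A i j * inner (X i) (Y j)))).
    by rewrite -mulr_sumr -Yj /tau' -be2; field; rewrite !gt_eqF.
  by move=> i _; rewrite innerZl innerZr; ring.
(* The weights balance the two terms of each bound, so that replacing [u0] by [u] and then [v0] by
   [v] costs at most t z n and 2 t z n. *)
have tz : 0 < (t * z)^-1 by rewrite invr_gt0 mulr_gt0.
have tz2 : 0 < z / t by rewrite divr_gt0.
have err1 := bilinear_value_young (fun i => u0 i - u i) v hA tz.
have err2 := bilinear_value_young u0 (fun j => v0 j - v j) hA tz2.
have {}err1 : bilinear_value A (fun i => u0 i - u i) v <= t * z * n%:R.
  have h1 : (t * z)^-1 * t ^+ 2 * (\sum_i inner (u0 i - u i) (u0 i - u i)) <= t * z * n%:R.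
    apply: (le_trans (ler_wpM2l _ Du)); first by rewrite mulr_ge0 ?exprn_ge0 // ltW.
    by rewrite le_eqVlt; apply/orP; left; apply/eqP; field; rewrite !gt_eqF.
  have h2 : (t * z)^-1^-1 * (\sum_j inner (v j) (v j)) <= t * z * n%:R.
    by rewrite invrK; apply: ler_wpM2l => //; rewrite mulr_ge0 // ltW.
  by lra.
have {}err2 : bilinear_value A u0 (fun j => v0 j - v j) <= 2 * (t * z * n%:R).
  have h1 : z / t * t ^+ 2 * (\sum_i inner (u0 i) (u0 i)) <= t * z * (2 * n%:R).
    have -> : z / t * t ^+ 2 = t * z by field; rewrite gt_eqF.
    by apply: ler_wpM2l => //; rewrite mulr_ge0 // ltW.
  have h2 : (z / t)^-1 * (\sum_j inner (v0 j - v j) (v0 j - v j)) <= t * z * n%:R.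
    apply: (le_trans (ler_wpM2l _ Dv)); first by rewrite ltW // invr_gt0.
    by rewrite le_eqVlt; apply/orP; left; apply/eqP; field; rewrite !gt_eqF.
  have tzn : 0 <= t * z * n%:R by rewrite !mulr_ge0 // ltW.
  by lra.
have dec : bilinear_value A u v = bilinear_value A u0 v0 -
   bilinear_value A (fun i => u0 i - u i) v - bilinear_value A u0 (fun j => v0 j - v j).
  by rewrite bilinear_valueBl bilinear_valueBr; ring.
apply: le_trans (entangled_value_ge A hu hv).
have -> : n%:R^-1 * (Num.sqrt (b / a) * (1 - z) - 3 * t * z) =
   (n%:R ^+ 2)^-1 * (Num.sqrt (b / a) * ((1 - z) * n%:R) - 3 * (t * z * n%:R)).
  by field; rewrite gt_eqF.
apply: ler_wpM2l; first by rewrite invr_ge0 exprn_ge0 // ltW.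
rewrite dec main.
have := ler_wpM2l (sqrtr_ge0 (b / a)) Stau'.
by lra.
Qed.

End PowerIteration.

(** * Typical sign matrices *)

Section RealEstimates.
Variable R : realType.

Lemma bernoulli_ge (x : R) k : 0 <= 1 + x -> 1 + k%:R * x <= (1 + x) ^+ k.
Proof.
move=> x1; elim: k => [|k IH]; first by rewrite mul0r addr0 expr0.
rewrite exprS; apply: le_trans (ler_wpM2l x1 IH).
rewrite -[k.+1%:R]natr1; have k0 : 0 <= k%:R :> R by rewrite ler0n.
by have := mulr_ge0 k0 (sqr_ge0 x); nra.
Qed.

(** Convexity: the right side is the chord over [0, 1]. *)
Lemma expr1D_le (x : R) p : 0 <= x <= 1 -> (1 + x) ^+ p <= 1 + (2 ^+ p - 1) * x.
Proof.
move=> /andP[x0 x1]; elim: p => [|p IH]; first by rewrite !expr0 subrr mul0r addr0.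
have p1 : 1 <= 2 ^+ p :> R by rewrite exprn_ege1 // ler1n.
rewrite exprS; apply: le_trans (ler_wpM2l _ IH) _; first by lra.
rewrite (exprS 2); move: (2 ^+ p) p1 => v v1.
have : 0 <= (v - 1) * (x * (1 - x)) by rewrite !mulr_ge0 //; lra.
by nra.
Qed.

Lemma exists_nat_ge (x : R) : exists N : nat, x <= N%:R.
Proof.
exists (Num.bound `|x|); apply: le_trans (ler_norm x) _; apply: ltW.
exact: archi_boundP (normr_ge0 x).
Qed.

End RealEstimates.

Section TypicalMatrices.
Variables (R : realType).

Definition frequency n (Q : pred (signs n)) : R := mean (fun s => (Q s)%:R).

Lemma markov_frequency n (f : signs n -> R) c : 0 < c -> (forall s, 0 <= f s) ->
  frequency (fun s => c < f s) <= mean f / c.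
Proof.
move=> c0 f0; rewrite [mean f / c]mulrC -meanZ; apply: ler_mean => s.
case: (ltP c (f s)) => h; last by rewrite mulr_ge0 // invr_ge0 ltW.
by rewrite ler_pdivlMl // mulr1 ltW.
Qed.

Lemma frequency_union n (Q Q1 Q2 Q3 : pred (signs n)) :
  (forall s, ~~ Q1 s -> ~~ Q2 s -> ~~ Q3 s -> Q s) ->
  1 - (frequency Q1 + frequency Q2 + frequency Q3) <= frequency Q.
Proof.
move=> h; rewrite lerBlDr -{1}(mean_cst n (1 : R)) -!meanD; apply: ler_mean => s.
have := h s; case: (Q s); case: (Q1 s); case: (Q2 s); case: (Q3 s) => //= h';
  rewrite ?addr0 ?add0r; lra.
Qed.

(** Transposing the signs permutes the sample space; this carries estimates for A A^T over to A^T
    A. *)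
Lemma mean_trmx n (f : 'M[R]_n -> R) :
  mean (fun s => f (signmx R s)^T) = mean (fun s => f (signmx R s)).
Proof.
pose tr (s : signs n) : signs n := [ffun e => s (e.2, e.1)].
have trK : involutive tr by move=> s; apply/ffunP => -[i j]; rewrite !ffunE.
rewrite /mean [in RHS](reindex_inj (can_inj trK)); congr (_ * _); apply: eq_bigr => s _.
by congr f; apply/matrixP => i j; rewrite !mxE /sgn ffunE.
Qed.

Lemma closed_walks_pinned n (i : 'I_n) m (s : signs n) :
  closed_walks R i (false, m) s = (gram R s ^+ m) i i.
Proof. by rewrite /closed_walks root_mx_false mxtrace_delta_mul. Qed.

Lemma mean_trace_le n k : (0 < n)%N ->
  mean (fun s : signs n => \tr (gram R s ^+ k)) <= n%:R * (4 * n%:R * error_factor R n k) ^+ k.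
Proof.
move=> n0; pose i0 := Ordinal n0.
have := @moment_le R n i0 k [:: (true, k)].
rewrite /half_length !big_seq1 /= leqnn => /(_ isT).
have -> : moment R i0 [:: (true, k)] = mean (fun s : signs n => \tr (gram R s ^+ k)).
  by apply: eq_mean => s; rewrite big_seq1 /closed_walks root_mx_true mul1r.
move/le_trans; apply; rewrite /main_order /=.
have g0 : 0 <= error_factor R n k by rewrite (le_trans ler01) // error_factor_ge1.
have := catalan_le R k; move: (catalan R k) => c ck.
have -> : n%:R * (4 * n%:R * error_factor R n k) ^+ k =
   4 ^+ k * (n%:R * (n%:R ^+ k * error_factor R n k ^+ k)) by rewrite !exprMn; ring.
have -> : n%:R ^+ k * c * n%:R * error_factor R n k ^+ k =
   c * (n%:R * (n%:R ^+ k * error_factor R n k ^+ k)) by ring.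
by apply: ler_wpM2r; rewrite ?mulr_ge0 ?exprn_ge0.
Qed.

(** The first summand is the excess of the second moment, linearized by the chord bound; the second
    is twice the deficit m^2 of the first moment. Both are relative errors multiplied by n. *)
Definition deviation_bound m : nat := (2 ^ m.*2 * (3 * m.*2.+1 ^ 5) + 2 * m ^ 2)%N.

(** Expand the square: the second moment is bounded above through two walks pinned at i, the first
    below through the returns. The leading parts 1 - 2 + 1 cancel, leaving O(1/n) for each of the n
    rows. *)
Lemma mean_deviation_le n m : (deviation_bound m < n)%N ->
  mean (fun s : signs n => deviation (n%:R ^+ m * catalan R m) m (signmx R s)) <=
  (deviation_bound m)%:R.
Proof.
move=> hn; have n0 : (0 < n)%N by exact: leq_trans hn.
have nR : 0 < n%:R :> R by rewrite ltr0n.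
set a := n%:R ^+ m * catalan R m.
have a0 : 0 < a by rewrite mulr_gt0 ?exprn_gt0 ?catalan_gt0.
have mn : (m <= n)%N.
  apply: ltnW; apply: leq_ltn_trans hn; rewrite /deviation_bound -mulnn; nia.
rewrite /deviation mean_sum -[leRHS]mulr1 -[X in _ <= _ * X](divff (lt0r_neq0 nR)).
rewrite mulrCA mulr_natl -[X in _ *+ X]card_ord -sumr_const; apply: ler_sum => i _.
have -> : mean (fun s : signs n => ((gram R s ^+ m) i i / a - 1) ^+ 2) =
    (a ^+ 2)^-1 * mean (fun s : signs n => (gram R s ^+ m) i i * (gram R s ^+ m) i i) +
    ((- 2 / a) * mean (fun s : signs n => (gram R s ^+ m) i i) + 1).
  rewrite -[X in _ = _ + (_ + X)](mean_cst n) -!meanZ -!meanD; apply: eq_mean => s.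
  by field; rewrite gt_eqF.
have second : mean (fun s : signs n => (gram R s ^+ m) i i * (gram R s ^+ m) i i) <=
    a ^+ 2 * error_factor R n m.*2 ^+ m.*2.
  have := @moment_le R n i m.*2 [:: (false, m); (false, m)].
  rewrite /half_length !big_cons !big_nil /= addn0 addnn leqnn => /(_ isT).
  rewrite /main_order /= !mulr1 -/a -expr2; apply: le_trans.
  rewrite le_eqVlt; apply/orP; left; apply/eqP; apply: eq_mean => s.
  by rewrite !big_cons big_nil mulr1 !closed_walks_pinned.
have first := mean_return_ge R m i.
have x0 : 0 <= 3 * m.*2.+1%:R ^+ 5 / n%:R :> R.
  by rewrite divr_ge0 ?ltW // mulr_ge0 // exprn_ge0.
have x1 : 3 * m.*2.+1%:R ^+ 5 / n%:R <= 1 :> R.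
  rewrite ler_pdivrMr // mul1r -natrX -natrM ler_nat; apply: ltnW; apply: leq_ltn_trans hn.
  by rewrite /deviation_bound; have := expn_gt0 2 m.*2; nia.
have g_le : error_factor R n m.*2 ^+ m.*2 <=
    1 + 2 ^+ m.*2 * (3 * m.*2.+1%:R ^+ 5 / n%:R).
  rewrite /error_factor; apply: le_trans (expr1D_le _ _) _; first by rewrite x0 x1.
  by rewrite lerD2l; apply: ler_wpM2r => //; lra.
have b_le : 1 - m%:R ^+ 2 / n%:R <= a^-1 * mean (fun s : signs n => (gram R s ^+ m) i i).
  rewrite ler_pdivlMl //; apply: le_trans first; rewrite /a -mulrA mulrCA.
  apply: ler_wpM2l; first by rewrite ltW // catalan_gt0.
  have -> : (n - m)%:R = n%:R * (1 - m%:R / n%:R) :> R.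
    by rewrite natrB //; field; rewrite gt_eqF.
  rewrite exprMn; apply: ler_wpM2l; first by rewrite exprn_ge0.
  have h : 0 <= 1 + - (m%:R / n%:R) :> R.
    by rewrite subr_ge0 ler_pdivrMr // mul1r ler_nat.
  have := bernoulli_ge m h.
  by have -> : 1 + m%:R * - (m%:R / n%:R) = 1 - m%:R ^+ 2 / n%:R :> R by ring.
have s_le : (a ^+ 2)^-1 * mean (fun s : signs n => (gram R s ^+ m) i i * (gram R s ^+ m) i i) <=
    error_factor R n m.*2 ^+ m.*2.
  by rewrite ler_pdivrMl // exprn_gt0.
have -> : (deviation_bound m)%:R / n%:R =
    2 ^+ m.*2 * (3 * m.*2.+1%:R ^+ 5 / n%:R) + 2 * (m%:R ^+ 2 / n%:R) :> R.
  by rewrite /deviation_bound natrD !natrM !natrX; field; rewrite gt_eqF.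
rewrite mulrAC -mulrA [_ / a]mulrC; lra.
Qed.

End TypicalMatrices.

(** * Tail bounds and the value of a typical matrix *)

Section Tails.
Variables (R : realType).

(** M^j has the form B B^T, with B = M^(j/2) for even j and B = M^((j-1)/2) A for odd j. *)
Lemma mxtrace_gram_exp_ge0 n (A : 'M[R]_n) j : 0 <= \tr ((A * A^T) ^+ j).
Proof.
have sq (B : 'M[R]_n) : 0 <= \tr (B * B^T).
  apply: sumr_ge0 => i _; rewrite mulmx_entry; apply: sumr_ge0 => l _.
  by rewrite mxE -expr2 sqr_ge0.
have MT i : ((A * A^T) ^+ i)^T = (A * A^T) ^+ i by rewrite trmx_exp trmxM trmxK.
rewrite -(odd_double_half j); case: (odd j) => /=.
  have := sq ((A * A^T) ^+ j./2 * A).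
  by rewrite trmxM MT !mulrA -[_ * A * A^T]mulrA -exprSr -exprD addSn addnn.
by have := sq ((A * A^T) ^+ j./2); rewrite MT -exprD addnn.
Qed.

(* The witness has 2^q about n^(1/10): large against log n, while (2^q)^5 is small
   against n. *)
Lemma trace_tail (e dl : R) : 0 < e -> 0 < dl -> exists N, forall n, (N <= n)%N ->
  exists q, frequency R (fun s : signs n =>
    ((2 + e) ^+ 2 * n%:R) ^+ (2 ^ q) < \tr (gram R s ^+ (2 ^ q))) <= dl.
Proof.
(* With e = 3 eta there is room for two factors 1 + eta: one for the error factor, one whose K-th
   power absorbs the prefactor n. *)
move=> e0 dl0; pose eta := e / 3; have eta0 : 0 < eta by rewrite divr_gt0.
(* Chosen so that C <= dl K^6 amounts to (2K)^10 <= dl (K eta / 16)^16. *)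
pose C := 2 ^+ 10 * (16 / eta) ^+ 16 : R.
have C0 : 0 < C by rewrite mulr_gt0 ?exprn_gt0 // divr_gt0.
have [K1 hK1] := exists_nat_ge (96 / eta).
have [K2 hK2] := exists_nat_ge (C / dl).
pose K0 := (K1 + K2 + 16)%N.
exists ((2 * K0) ^ 10)%N => n hn.
have n0 : (0 < n)%N by apply: leq_trans hn; rewrite expn_gt0 /K0; lia.
(* This makes K the power of 2 with K^10 <= n < (2K)^10. *)
pose q := (trunc_log 2 n %/ 10)%N; exists q; pose K := (2 ^ q)%N.
have Kn : (K ^ 10 <= n)%N.
  apply: leq_trans (trunc_logP (isT : (1 < 2)%N) n0).
  by rewrite -expnM leq_exp2l // leq_trunc_div.
have nK : (n < (2 * K) ^ 10)%N.
  apply: leq_trans (trunc_log_ltn n (isT : (1 < 2)%N)) _.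
  by rewrite -expnS -expnM leq_exp2l //; have := ltn_ceil (trunc_log 2 n) (isT : (0 < 10)%N).
have KK0 : (K0 <= K)%N.
  rewrite leqNgt; apply/negP => h; have := leq_trans hn (ltnW nK).
  rewrite leq_exp2r //; lia.
have K1K : (K1 <= K)%N by apply: leq_trans KK0; rewrite /K0 -addnA leq_addr.
have K2K : (K2 <= K)%N by apply: leq_trans KK0; rewrite /K0 addnAC leq_addl.
have K16 : (16 <= K)%N by apply: leq_trans KK0; rewrite leq_addl.
have q4 : (4 <= q)%N by rewrite -(leq_exp2l (m := 2)).
have [j Kj] : exists j, K = (j * 16)%N.
  by exists (2 ^ (q - 4))%N; rewrite /K -{1}(subnK q4) expnD.
have nR : 0 < n%:R :> R by rewrite ltr0n.
have KR : 16 <= K%:R :> R by rewrite (ler_nat R 16).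
have g_le : error_factor R n K <= 1 + eta.
  rewrite /error_factor lerD2l ler_pdivrMr //.
  apply: (le_trans (y := 3 * (2 * K%:R) ^+ 5)).
    by rewrite ler_pM2l // lerXn2r ?nnegrE ?mulr_ge0 // -natrM ler_nat; lia.
  apply: (le_trans (y := eta * K%:R ^+ 10)); last first.
    by rewrite ler_pM2l // -natrX ler_nat.
  have h96 : 96 <= eta * K%:R.
    rewrite -ler_pdivrMl // mulrC; apply: le_trans hK1 _.
    by rewrite ler_nat.
  rewrite exprMn; have -> : (K%:R : R) ^+ 10 = K%:R * K%:R ^+ 4 * K%:R ^+ 5 by ring.
  have k4 : 1 <= K%:R ^+ 4 :> R by rewrite exprn_ege1 //; lra.
  rewrite (mulrA 3) (mulrA eta); apply: ler_wpM2r; first by rewrite exprn_ge0 //; lra.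
  have -> : 3 * 2 ^+ 5 = 96 :> R by ring.
  rewrite (mulrA eta); apply: le_trans h96 _; apply: ler_peMr => //.
  by rewrite mulr_ge0 // ?ltW //; lra.
have f_ge0 (s : signs n) : 0 <= \tr (gram R s ^+ K) by exact: mxtrace_gram_exp_ge0.
have t0 : 0 < (2 + e) ^+ 2 * n%:R by rewrite mulr_gt0 // exprn_gt0 //; lra.
apply: le_trans (markov_frequency (exprn_gt0 _ t0) f_ge0) _.
rewrite ler_pdivrMr ?exprn_gt0 //; apply: (le_trans (mean_trace_le R K n0)).
(* Bernoulli on K/16 factors, raised to the power 16, gives growth of order K^16, which beats n <
   (2K)^10. *)
have grow : n%:R <= dl * (1 + eta) ^+ K.
  have b : j%:R * eta <= (1 + eta) ^+ j.
    have := @bernoulli_ge R eta j; have -> : 0 <= 1 + eta by lra.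
    by move=> /(_ isT); lra.
  have b16 : (K%:R * eta / 16) ^+ 16 <= (1 + eta) ^+ K.
    rewrite Kj exprM natrM; have -> : j%:R * 16 * eta / 16 = j%:R * eta by field.
    by rewrite lerXn2r ?nnegrE ?mulr_ge0 ?exprn_ge0 //; lra.
  apply: (le_trans (y := dl * (K%:R * eta / 16) ^+ 16)); last by rewrite ler_pM2l.
  apply: (le_trans (y := (2 * K%:R) ^+ 10)).
    by rewrite -natrM -natrX ler_nat ltnW.
  have hC : C <= dl * K%:R.
    rewrite -ler_pdivrMl // mulrC; apply: le_trans hK2 _.
    by rewrite ler_nat.
  have k5 : 1 <= K%:R ^+ 5 :> R by rewrite exprn_ege1 //; lra.
  have hC6 : C <= dl * K%:R ^+ 6.
    apply: le_trans hC _; rewrite exprS (mulrA dl); apply: ler_peMr => //.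
    by rewrite mulr_ge0 ?ltW //; lra.
  have -> : dl * (K%:R * eta / 16) ^+ 16 = K%:R ^+ 10 * (eta / 16) ^+ 16 * (dl * K%:R ^+ 6).
    by rewrite !exprMn; ring.
  apply: (le_trans (y := K%:R ^+ 10 * (eta / 16) ^+ 16 * C)); last first.
    by apply: ler_wpM2l => //; rewrite mulr_ge0 ?exprn_ge0 // ?divr_ge0 //; lra.
  have -> : K%:R ^+ 10 * (eta / 16) ^+ 16 * C =
      (2 * K%:R) ^+ 10 * ((eta / 16) * (16 / eta)) ^+ 16 by rewrite /C !exprMn; ring.
  have -> : (eta / 16) * (16 / eta) = 1 by field; rewrite gt_eqF.
  by rewrite expr1n mulr1.
have q_le : 4 * n%:R * error_factor R n K * (1 + eta) <= (2 + e) ^+ 2 * n%:R.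
  have h : error_factor R n K * (1 + eta) <= (1 + eta) * (1 + eta).
    by apply: ler_wpM2r => //; lra.
  have -> : (2 + e) ^+ 2 * n%:R = n%:R * (2 + e) ^+ 2 by ring.
  have -> : 4 * n%:R * error_factor R n K * (1 + eta) =
     n%:R * (4 * (error_factor R n K * (1 + eta))) by ring.
  rewrite ler_pM2l //; have -> : e = 3 * eta by rewrite /eta; field.
  by nra.
have g0 : 0 <= error_factor R n K.
  by rewrite addr_ge0 // divr_ge0 // mulr_ge0 // exprn_ge0.
apply: le_trans (ler_wpM2r _ grow) _.
  by rewrite exprn_ge0 // !mulr_ge0 // ltW.
rewrite -(mulrA dl) -exprMn; apply: ler_wpM2l; first exact: ltW.
rewrite [X in X ^+ _ <= _]mulrC; apply: lerXn2r; rewrite ?nnegrE ?(ltW t0) //.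
by rewrite !mulr_ge0 //; lra.
Qed.

Lemma deviation_tail m (z dl : R) : 0 < z -> 0 < dl -> exists N, forall n, (N <= n)%N ->
  frequency R (fun s : signs n => z ^+ 2 * n%:R <
    deviation (n%:R ^+ m * catalan R m) m (signmx R s)) <= dl.
Proof.
move=> z0 dl0; set D := deviation_bound m.
have [N1 hN1] := exists_nat_ge (D%:R / (z ^+ 2 * dl)).
exists (N1 + D).+1 => n hn.
have n0 : 0 < n%:R :> R by rewrite ltr0n; lia.
have z2 : 0 < z ^+ 2 by rewrite exprn_gt0.
apply: le_trans (markov_frequency _ _) _; first by rewrite mulr_gt0.
  by move=> s; apply: sumr_ge0 => i _; exact: sqr_ge0.
rewrite ler_pdivrMr ?mulr_gt0 //; apply: le_trans (mean_deviation_le _ _) _; first by lia.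
rewrite ler_pdivrMr ?mulr_gt0 // in hN1; apply: le_trans hN1 _.
have -> : dl * (z ^+ 2 * n%:R) = n%:R * (z ^+ 2 * dl) by ring.
by apply: ler_wpM2r; rewrite ?mulr_ge0 ?ler_nat // ?ltW //; lia.
Qed.

Lemma typical_value (eps dl : R) : 0 < eps -> 0 < dl -> exists N, forall n, (N <= n)%N ->
  1 - dl <= frequency R (fun s : signs n =>
    `|Num.sqrt n%:R * entangled_value (signmx R s) - 2| <= eps).
Proof.
move=> eps0 dl0; pose e := Num.min eps 1.
have e0 : 0 < e by rewrite lt_min eps0 ltr01.
have e1 : e <= 1 by rewrite ge_min lexx orbT.
have ee : e <= eps by rewrite ge_min lexx.
have dl3 : 0 < dl / 3 by rewrite divr_gt0.
(* The lower estimate loses at most 2z + 9z = e/4 through [z], and e/4 through the Catalan ratio. *)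
pose z := e / 44; have z0 : 0 < z by rewrite divr_gt0.
have z1 : 0 < z <= 1 by rewrite z0 /=; rewrite /z; lra.
(* Large enough for C_(2k+1)/C_(2k) = (8k+2)/(2k+2) to be at least (2 - e/4)^2. *)
have [k hk] := exists_nat_ge (12 / e).
have [N1 h1] := trace_tail e0 dl3.
have [N2 h2] := deviation_tail k.*2 z0 dl3.
have [N3 h3] := deviation_tail k.*2.+1 z0 dl3.
exists (N1 + N2 + N3).+1 => n hn.
have n0 : (0 < n)%N by exact: leq_ltn_trans hn.
have /andP[/andP[nN1 nN2] nN3] : (N1 <= n)%N && (N2 <= n)%N && (N3 <= n)%N.
  by clear -hn; lia.
have nR : 0 < n%:R :> R by rewrite ltr0n.
have [q hq] : exists q, frequency R (fun s : signs n =>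
    ((2 + e) ^+ 2 * n%:R) ^+ (2 ^ q) < \tr (gram R s ^+ (2 ^ q))) <= dl / 3.
  exact: h1.
have {}h2 : frequency R (fun s : signs n => z ^+ 2 * n%:R <
    deviation (n%:R ^+ k.*2 * catalan R k.*2) k.*2 (signmx R s)) <= dl / 3.
  exact: h2.
have {}h3 : frequency R (fun s : signs n => z ^+ 2 * n%:R <
    deviation (n%:R ^+ k.*2.+1 * catalan R k.*2.+1) k.*2.+1 (signmx R s)^T) <= dl / 3.
  rewrite /frequency (mean_trmx (fun A : 'M[R]_n => ((z ^+ 2 * n%:R <
    deviation (n%:R ^+ k.*2.+1 * catalan R k.*2.+1) k.*2.+1 A)%R)%:R)).
  exact: h3.
set Q1 := (fun s : signs n => _ < _) in hq.
set Q2 := (fun s : signs n => _ < _) in h2.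
set Q3 := (fun s : signs n => _ < _) in h3.
apply: (le_trans (y := 1 - (frequency R Q1 + frequency R Q2 + frequency R Q3))); first by lra.
apply: frequency_union => s; rewrite /Q1 /Q2 /Q3 -!leNgt => g1 g2 g3.
pose t := (2 + e) * Num.sqrt n%:R.
have sn : 0 < Num.sqrt n%:R :> R by rewrite sqrtr_gt0.
have sn2 : Num.sqrt n%:R ^+ 2 = n%:R :> R by rewrite sqr_sqrtr // ltW.
have t0 : 0 < t by rewrite mulr_gt0 //; lra.
have t2 : t ^+ 2 = (2 + e) ^+ 2 * n%:R by rewrite exprMn sn2.
have hop : op_norm_sq_le (signmx R s) (t ^+ 2).
  by apply: (@op_norm_trace R n _ _ q); rewrite ?sqr_ge0 // t2.
set V := entangled_value _.
have upper : Num.sqrt n%:R * V <= 2 + e.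
  apply: (le_trans (ler_wpM2l (ltW sn) (entangled_value_le n0 t0 hop))).
  rewrite le_eqVlt; apply/orP; left; apply/eqP; rewrite /t -{3}sn2; field.
  by rewrite gt_eqF.
set C0 := catalan R k.*2 in g2; set C1 := catalan R k.*2.+1 in g3.
have C00 : 0 < C0 by exact: catalan_gt0.
have C10 : 0 < C1 by exact: catalan_gt0.
set a := n%:R ^+ k.*2 * C0 in g2; set b := n%:R ^+ k.*2.+1 * C1 in g3.
have a0 : 0 < a by rewrite mulr_gt0 // exprn_gt0.
have b0 : 0 < b by rewrite mulr_gt0 // exprn_gt0.
have low := power_iteration_value n0 a0 b0 t0 z1 hop g2 g3.
rewrite -/V in low.
have kR : 12 <= k%:R * e by rewrite ler_pdivrMr in hk.
have ba : b / a = n%:R * (C1 / C0).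
  by rewrite /a /b (exprS n%:R); field; rewrite ?expf_neq0 ?gt_eqF.
pose rho := Num.sqrt (C1 / C0).
have rho_ge : 2 - e / 4 <= rho.
  have -> : 2 - e / 4 = Num.sqrt ((2 - e / 4) ^+ 2) by rewrite sqrtr_sqr ger0_norm //; lra.
  apply: ler_wsqrtr; rewrite ler_pdivlMr //.
  have := catalanS R k.*2; rewrite -/C0 -/C1 -mul2n natrM => h.
  have k0 : 0 <= k%:R :> R by rewrite ler0n.
  rewrite -(ler_pM2l (_ : 0 < 2 * k%:R + 2)); last by lra.
  rewrite h (mulrA (2 * k%:R + 2)); apply: ler_wpM2r; first exact: ltW.
  by nra.
have sba : Num.sqrt (b / a) = Num.sqrt n%:R * rho by rewrite ba sqrtrM // ltW.
have lower : rho * (1 - z) - 3 * (2 + e) * z <= Num.sqrt n%:R * V.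
  apply: le_trans (ler_wpM2l (ltW sn) low); rewrite sba /t.
  rewrite le_eqVlt; apply/orP; left; apply/eqP; rewrite -{2}sn2; field.
  by rewrite gt_eqF.
rewrite ler_distl; apply/andP; split; last by lra.
apply: le_trans lower.
have : (2 - e / 4) * (1 - z) <= rho * (1 - z) by apply: ler_wpM2r => //; lra.
have : 3 * (2 + e) * z <= 9 * z by apply: ler_wpM2r; lra.
have : e / 4 * z >= 0 by rewrite mulr_ge0 //; lra.
by rewrite /z; lra.
Qed.

End Tails.

(** * Random sign matrices *)

Local Open Scope classical_set_scope.
Local Open Scope ring_scope.

Section UniformSigns.
Context (d : measure_display) (T : measurableType d) (R : realType) (P : probability T R).
Variables (n : nat) (A : 'I_n -> 'I_n -> {RV P >-> R}).
Hypothesis hA : random_sign_matrix A.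

Let outcome (s : signs n) : set T :=
  \bigcap_(e in [set` [set: 'I_n * 'I_n]%SET]) (A e.1 e.2 @^-1` [set sgn R s e]).

Let outcomeP s w : outcome s w <-> \matrix_(i, j) A i j w = signmx R s.
Proof.
split=> [h|/matrixP h [i j] _ /=].
  by apply/matrixP => i j; rewrite !mxE; apply: (h (i, j)); rewrite /= inE.
by have := h i j; rewrite !mxE.
Qed.

Let measurable_outcome s : measurable (outcome s).
Proof.
apply: fin_bigcap_measurable; first exact: finite_finset.
move=> e _; rewrite -[X in measurable X]setTI.
by apply: measurable_funPT => //; exact: measurable_set1.
Qed.

Let probability_outcome s : P (outcome s) = (#|signs n|%:R^-1)%:E.
Proof.
have [hU hI] := hA.
rewrite /outcome (hI [set: 'I_n * 'I_n]%SET (fun e => [set sgn R s e])); last first.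
  by move=> e; exact: measurable_set1.
rewrite (eq_bigr (fun=> (2^-1)%:E)) => [|[i j] _].
  rewrite prodEFin prodr_const cardsT card_ffun card_bool natrX exprVn.
  by [].
have [_ h1 hN1] := hU i j; rewrite /sgn; case: (s (i, j)) => /=.
  by rewrite expr1.
by rewrite expr0.
Qed.

(** By independence every sign matrix has the same probability, and an event about the matrix is a
    finite disjoint union of such outcomes. *)
Lemma probability_sign_matrix (Q : pred 'M[R]_n) :
  P [set w | Q (\matrix_(i, j) A i j w)] = (frequency R (fun s : signs n => Q (signmx R s)))%:E.
Proof.
have N1 : (-1 : R) <> 1 by lra.
pose good : pred (signs n) := fun s => Q (signmx R s).
have -> : [set w | Q (\matrix_(i, j) A i j w)] = \bigcup_(s in [set` good]) outcome s.
  apply/seteqP; split=> [w /= hw|w [s hs /outcomeP sw]]; last by rewrite /= sw.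
  (* The entry -1 is coded by [true], in accordance with (-1)^1. *)
  pose s : signs n := [ffun e => A e.1 e.2 w == -1].
  have hs : \matrix_(i, j) A i j w = signmx R s.
    apply/matrixP => i j; rewrite !mxE /sgn ffunE /=.
    have [h _ _] := hA.1 i j; case: (h w) => hw1; rewrite hw1; last by rewrite eqxx expr1.
    by rewrite gt_eqF ?expr0 //; lra.
  by exists s; [rewrite /= /good /in_mem /= -hs | apply/outcomeP].
rewrite measure_fin_bigcup; first last.
- by move=> s _; exact: measurable_outcome.
- apply/trivIsetP => s s' _ _ ss'; apply/seteqP; split=> // w [/outcomeP sw /outcomeP]; rewrite sw => /matrixP h.
  move/eqP: ss'; apply; apply/ffunP => -[i j]; have := h i j; rewrite !mxE /sgn.
  by case: (s _); case: (s' _); rewrite ?expr1 ?expr0 // => h'; case: N1 => //.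
- exact: finite_finpred.
rewrite -(@bigfs _ _ _ _ (index_enum (signs n)) good) ?index_enum_uniq //; last first.
  by move=> s _; rewrite mem_index_enum.
rewrite (eq_bigr (fun=> (#|signs n|%:R^-1)%:E)) => [|s _]; last exact: probability_outcome.
rewrite sumEFin /frequency /mean mulr_sumr big_mkcond /=; congr (_%:E).
by apply: eq_bigr => s _; rewrite /good; case: (Q _); rewrite ?mulr1 ?mulr0.
Qed.

End UniformSigns.

Theorem theorem1 (R : realType) (d : nat -> measure_display)
    (T : forall n : nat, measurableType (d n))
    (P : forall n : nat, probability (T n) R)
    (A : forall n : nat, 'I_n -> 'I_n -> {RV (P n) >-> R})
    (hA : forall n : nat, (0 < n)%N -> random_sign_matrix (A n))
    (eps : R) (heps : 0 < eps) :
  (fun n : nat => P n [set w : T n |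
     `|Num.sqrt n%:R * entangled_value (\matrix_(i < n, j < n) A n i j w) - 2|
       <= eps]) @ \oo --> (1%:E : \bar R).
Proof.
pose Q n (M : 'M[R]_n) := `|Num.sqrt n%:R * entangled_value M - 2| <= eps.
pose f n := frequency R (fun s : signs n => Q n (signmx R s)).
have Pf n : (0 < n)%N ->
    P n [set w : T n | Q n (\matrix_(i < n, j < n) A n i j w)] = (f n)%:E.
  by move=> n0; exact: (probability_sign_matrix (hA n n0) (Q n)).
have f_le1 n : f n <= 1.
  rewrite -(mean_cst n (1 : R)); apply: ler_mean => s.
  by case: (Q _ _).
(* The two sequences are identified from n = 1 on, where [hA] applies. *)
apply: (@cvg_trans _ (EFin \o f @ \oo)).
  by apply: near_eq_cvg; exists 1%N => // n /= n1; rewrite -Pf.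
apply: cvg_EFin; first by near=> n.
apply/cvgrPdist_le => dl dl0; have [N hN] := typical_value heps dl0.
exists N => // n /= Nn; have := hN n Nn; rewrite -/(f n) => h.
by rewrite ger0_norm ?subr_ge0 // lerBlDr addrC -lerBlDr.
Unshelve. all: by end_near.
Qed.
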